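(* For every positive integer $\ell$ there exists a partially hyperbolic diffeomorphism $g$ of $\mathbb{T}^2\times S^1\times S^1$ such that $g$ admits $\ell$ (pairwise distinct) physical measures $\mu_1,\dots,\mu_\ell$, the union of basins $\bigcup_{i=1}^{\ell}B(\mu_i)$ has full Lebesgue measure in $\mathbb{T}^2\times S^1\times S^1$, and each physical measure of $g$ is non-hyperbolic.
   Context: $\mathbb{T}^2=\mathbb{R}^2/\mathbb{Z}^2$ and $S^1=\mathbb{R}/\mathbb{Z}$, with their standard smooth and flat Riemannian structures. Let $M$ be a smooth connected compact Riemannian manifold and $f:M\to M$ a ($C^1$) diffeomorphism. Physical measure: for an $f$-invariant Borel probability measure $\mu$, its basin is $B(\mu)=\{x\in M:\ \frac1n\sum_{j=0}^{n-1}\delta_{f^j(x)}\to\mu \text{ in the weak}^* \text{ topology as } n\to+\infty\}$; $\mu$ is called a physical measure of $f$ if $B(\mu)$ has positive Lebesgue measure. Hyperbolic measure: an invariant measure is hyperbolic if all of its Lyapunov exponents are non-zero (at almost every point); it is non-hyperbolic if it is not hyperbolic. Partially hyperbolic: $f$ is partially hyperbolic if there are a splitting of the tangent bundle $TM=E^u\oplus F$ into nonzero subbundles with $Df(E^u)=E^u$ and $Df(F)=F$, and constants $C>0$, $\lambda\in(0,1)$, such that for every $x\in M$, all unit vectors $v^u\in E^u_x$, $v\in F_x$ and every integer $n\ge 1$, $\frac{\|Df^n(v)\|}{\|Df^n(v^u)\|}\le C\lambda^n$ and $\|Df^{-n}(v^u)\|\le C\lambda^n$. *)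

(* Defs.v *)
From HB Require Import structures.
From mathcomp Require Import all_boot all_order all_algebra.
From mathcomp Require Import generic_quotient.
From mathcomp Require Import all_classical all_reals all_analysis.

Set Implicit Arguments.
Unset Strict Implicit.
Unset Printing Implicit Defensive.

Import Order.TTheory GRing.Theory Num.Theory.
Import numFieldNormedType.Exports.

Local Open Scope classical_set_scope.
Local Open Scope ring_scope.

Section Torus.
Variables (R : realType) (d : nat).

Definition torus_rel : rel 'rV[R]_d :=
  fun x y => [forall i, (x - y) 0 i \is a Num.int].

Lemma torus_rel_equiv : equiv_class_of torus_rel.
Proof.
split=> [x|x y|y x z].
- by apply/forallP => i; rewrite subrr mxE rpred0.
- by apply/forallP/forallP => h i; have := h i; rewrite !mxE -rpredN opprB.
- move=> /forallP xy /forallP yz; apply/forallP => i.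
  by rewrite -(subrKA y) mxE rpredD.
Qed.

Canonical torus_equivRel := EquivRelPack torus_rel_equiv.

(* R^d / Z^d with the quotient topology and its Borel sigma-algebra. For d = 4
   this is T^2 x S^1 x S^1 = R^2/Z^2 x R/Z x R/Z, the first two coordinates being
   those of T^2. *)
Definition torus := quotient_topology {eq_quot torus_equivRel}%qT.

HB.instance Definition _ := Topological.copy torus
  (quotient_topology {eq_quot torus_equivRel}%qT).
HB.instance Definition _ := Quotient.copy torus
  (quotient_topology {eq_quot torus_equivRel}%qT).
HB.instance Definition _ := isPointed.Build torus (\pi_torus 0)%qT.

Definition torus_proj (x : 'rV[R]_d) : torus := (\pi_torus x)%qT.

HB.instance Definition _ := Measurable.copy torus
  (g_sigma_algebraType (@open torus)).

End Torus.

Section Calculus.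
Variables (R : realType) (d : nat).
Local Notation T := (torus R d).
Implicit Types (g : T -> T) (p : T).

(* The flat metric is Euclidean, whereas the library norm on row vectors is the
   sup norm. *)
Definition enorm (v : 'rV[R]_d) : R := Num.sqrt (\sum_i v 0 i ^+ 2).

(* The projection [torus_proj] is a local diffeomorphism whose local inverses are the
   charts of the torus, and it identifies every tangent space with row vectors.
   [A] is the matrix of the differential of [g] at [p] when it is the Jacobian
   matrix of a local lift of [g]; it acts on the right, as in [v *m A]. *)
Definition tdiff_at g p (A : 'M[R]_d) : Prop :=
  exists (x : 'rV[R]_d) (F : 'rV[R]_d -> 'rV[R]_d),
    [/\ torus_proj x = p, \forall y \near x, torus_proj (F y) = g (torus_proj y),
        differentiable F x & jacobian F x = A].

Definition tdiff g p : 'M[R]_d := xget 0 [set A | tdiff_at g p A].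

Definition C1 g : Prop :=
  (forall p, exists A, tdiff_at g p A) /\ continuous (tdiff g).

Definition C1_diffeo g ginv : Prop :=
  [/\ cancel g ginv, cancel ginv g, C1 g & C1 ginv].

(* A field of subspaces is a field of square matrices, read through their row
   spaces. *)
Definition subbundle (k : nat) (E : T -> 'M[R]_d) : Prop :=
  forall p, exists e : T -> 'M[R]_(k, d), \forall q \near p,
    [/\ {for q, continuous e}, row_free (e q) & (e q == E q)%MS].

Definition nonzero_subbundle (E : T -> 'M[R]_d) : Prop :=
  exists2 k, (0 < k)%N & subbundle k E.

Definition invariant_bundle g (E : T -> 'M[R]_d) : Prop :=
  forall p, (E p *m tdiff g p == E (g p))%MS.

Definition partially_hyperbolic g ginv : Prop :=
  exists Eu F : T -> 'M[R]_d,
  [/\ nonzero_subbundle Eu /\ nonzero_subbundle F,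
      forall p, (Eu p + F p == 1%:M)%MS /\ (Eu p :&: F p)%MS = 0,
      invariant_bundle g Eu /\ invariant_bundle g F &
      exists C lambda : R, [/\ 0 < C, 0 < lambda < 1 &
        forall p (vu v : 'rV[R]_d) (n : nat),
          (vu <= Eu p)%MS -> enorm vu = 1 -> (v <= F p)%MS -> enorm v = 1 ->
          (0 < n)%N ->
          enorm (v *m tdiff (iter n g) p) / enorm (vu *m tdiff (iter n g) p)
            <= C * lambda ^+ n /\
          enorm (vu *m tdiff (iter n ginv) p) <= C * lambda ^+ n]].

End Calculus.

Section Ergodic.
Variables (R : realType) (d : nat).
Local Notation T := (torus R d).
Implicit Types (g : T -> T) (p : T) (mu : probability T R).

Definition invariant_measure g mu : Prop :=
  forall A : set T, measurable A -> mu (g @^-1` A) = mu A.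

Definition empirical_measure g p (n : nat) : {measure set T -> \bar R} :=
  mscale (n%:R^-1 : R)%:nng (msum (fun j => dirac (iter j g p)) n).

Definition weak_star_cvg (nu : nat -> {measure set T -> \bar R}) mu : Prop :=
  forall phi : T -> R, continuous phi ->
    \int[nu n]_x phi x @[n --> \oo] --> \int[mu]_x phi x.

Definition basin g mu : set T :=
  [set p | weak_star_cvg (empirical_measure g p) mu].

(* At almost every point, by Oseledets, the limit exists for every [v != 0] and
   its values are exactly the Lyapunov exponents. *)
Definition lyapunov_exponent g p (chi : R) : Prop :=
  exists2 v : 'rV[R]_d, v != 0 &
    n%:R^-1 * ln (enorm (v *m tdiff (iter n g) p)) @[n --> \oo] --> chi.

Definition hyperbolic_measure g mu : Prop :=
  \forall p \ae mu, forall chi, lyapunov_exponent g p chi -> chi != 0.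

End Ergodic.

Section Lebesgue.
Variable R : realType.
Local Notation leb := (@lebesgue_measure R).

Definition row4 (x : R * R * R * R) : 'rV[R]_4 :=
  \row_(i < 4) [:: x.1.1.1; x.1.1.2; x.1.2; x.2]`_i.

Definition unit_cube : set (R * R * R * R) :=
  `[0, 1[ `*` `[0, 1[ `*` `[0, 1[ `*` `[0, 1[.

(* Push-forward of the Lebesgue measure of the fundamental domain [0, 1[^4. *)
Definition lebesgue_torus4 (A : set (torus R 4)) : \bar R :=
  (leb \x leb \x leb \x leb)%E (unit_cube `&` (@torus_proj R 4 \o row4) @^-1` A).

Definition physical_measure (g : torus R 4 -> torus R 4)
    (mu : probability (torus R 4) R) : Prop :=
  invariant_measure g mu /\ (0 < lebesgue_torus4 (basin g mu))%E.

End Lebesgue.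

(* Main.v *)
(* The map is the product of the cat map (x, y) |-> (2x + y, x + y) of T^2 with two
   circle maps s |-> s + (1 - cos(2 pi l s)) / (4 pi l) and
   t |-> t + (1 - cos(2 pi t)) / (4 pi). A circle map of this form moves every point
   monotonically towards the next fixed point i / l, and its derivative at the fixed
   points is 1. Hence every orbit has a zero Lyapunov exponent in the direction of s,
   so no invariant measure is hyperbolic. The derivatives of the circle maps are at most
   3/2, less than the expansion of the cat map, which gives the domination. Almost every
   (x, y) is equidistributed by the cat map, so that almost every point of T^4 is in the
   basin of one of the measures Leb x delta_(i/l) x delta_0.
   Equidistribution of almost every point: the cat map sends characters to characters,
   and the iterates of a nontrivial character are pairwise orthogonal; so their averages
   converge to 0 almost everywhere, by the elementary law of large numbers for bounded
   orthogonal sequences. Continuous functions are then approximated uniformly by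
   trigonometric polynomials, with Fejer kernels. *)
From HB Require Import structures.
From mathcomp Require Import all_boot all_order all_algebra.
From mathcomp Require Import all_classical all_reals all_analysis.
From mathcomp Require Import measurable_realfun.
From mathcomp Require Import ring lra zify.
Require Import Defs.

Set Implicit Arguments.
Unset Strict Implicit.
Unset Printing Implicit Defensive.

Import Order.TTheory GRing.Theory Num.Theory.
Import numFieldNormedType.Exports.

Local Open Scope classical_set_scope.
Local Open Scope ring_scope.

(** * Maps of the torus and their lifts *)

Section TorusTheory.
Variables (R : realType) (d : nat).
Local Notation T := (torus R d).
Local Notation proj := (@torus_proj R d).

(** Everything is computed on lifts to [R^4], where the circle factors become increasing degree-one
    maps of the line all of whose orbits converge. As this convergence holds for every [s] and [t],
    the only exceptional set is a null set [N] of pairs [(x, y)], common to all sinks and all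
    observables. The complement of the basins lies over [N] and each basin contains a box, so
    monotonicity of the measure settles both claims on basins without discussing their
    measurability. Semistability reconciles a zero exponent with a basin of positive measure: a
    fixed point that attracts from one side only may have slope 1 and still capture a whole arc.
    Dividing the bump by [4 pi l] makes the slope [1 + sin(2 pi l s) / 2], whose bounds do not
    depend on [l]. Since the slopes along each orbit converge, the zero exponent is obtained at
    every point by Cesaro means, with no ergodic theorem in the circle directions. *)

Definition intvec (k : 'rV[R]_d) := forall i, k 0 i \is a Num.int.

Lemma torus_projP (x y : 'rV[R]_d) : proj x = proj y <-> intvec (x - y).
Proof.
split=> [xy i|xy].
  have /eqmodP : (\pi_({eq_quot (torus_equivRel R d)})%qT x =
    \pi_({eq_quot (torus_equivRel R d)})%qT y)%qT by exact: xy.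
  by move=> /forallP.
suff : (\pi_({eq_quot (torus_equivRel R d)})%qT x =
  \pi_({eq_quot (torus_equivRel R d)})%qT y)%qT by exact.
by apply/eqmodP/forallP.
Qed.

Lemma torus_projD (x k : 'rV[R]_d) : intvec k -> proj (x + k) = proj x.
Proof. by move=> hk; apply/torus_projP; rewrite addrAC subrr add0r. Qed.

Lemma torus_proj_repr (p : T) : proj (repr p) = p.
Proof. exact: reprK. Qed.

Lemma torus_proj_continuous : continuous proj.
Proof. exact: pi_continuous. Qed.

Lemma torus_continuousP (Z : topologicalType) (f : T -> Z) :
  continuous (f \o proj) -> continuous f.
Proof. by move=> h; apply/quotient_continuous. Qed.

(** The representative [repr p] is arbitrary; the value is independent of it once [G] is
    equivariant. *)
Definition torus_map (G : 'rV[R]_d -> 'rV[R]_d) (p : T) : T := proj (G (repr p)).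

(** Only integrality of the increment is asked, not equality with [k]: the cat map transforms
    integer translations by its matrix. *)
Definition equivariant (G : 'rV[R]_d -> 'rV[R]_d) :=
  forall x k, intvec k -> intvec (G (x + k) - G x).

Lemma torus_map_proj G x : equivariant G -> torus_map G (proj x) = proj (G x).
Proof.
move=> eG; apply/torus_projP.
have /torus_projP h := torus_proj_repr (proj x).
have -> : repr (proj x) = x + (repr (proj x) - x) by rewrite addrC subrK.
exact: eG.
Qed.

Lemma iter_torus_map_proj G n x : equivariant G ->
  iter n (torus_map G) (proj x) = proj (iter n G x).
Proof. by move=> eG; elim: n => //= n ->; rewrite torus_map_proj. Qed.

Lemma row_jacobian (f : 'rV[R]_d -> 'rV[R]_d) x i : differentiable f x ->
  row i (jacobian f x) = 'D_(delta_mx 0 i) f x.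
Proof. by move=> df; rewrite rowE deriveEjacobian. Qed.

(* [F - H] takes integral values near [x] and is continuous at [x], so it is constant
   near [x]. *)
Lemma jacobian_lift_unique (F H : 'rV[R]_d -> 'rV[R]_d) x :
  differentiable F x -> differentiable H x ->
  (\forall y \near x, proj (F y) = proj (H y)) -> jacobian F x = jacobian H x.
Proof.
move=> dF dH FH.
have FHx : intvec (F x - H x) by apply/torus_projP/(nbhs_singleton FH).
have cFH : {for x, continuous (fun y => F y - H y)}.
  by apply: continuousB; exact: differentiable_continuous.
have nFH : {near x, F =1 H \+ cst (F x - H x)}.
  have /cvgrPdist_lt/(_ 1 ltr01) close := cFH.
  near=> y.
  have /torus_projP FHy : proj (F y) = proj (H y) by near: y.
  suff -> : F x - H x = F y - H y by rewrite /= addrC subrK.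
  apply/rowP => i; apply/eqP; rewrite -subr_eq0.
  have : `|((F x - H x) - (F y - H y)) 0 i| < 1.
    have : `|F x - H x - (F y - H y)| < 1 by near: y.
    apply: le_lt_trans; rewrite [leRHS]/Num.norm/= mx_normrE.
    exact: (le_bigmax _ (fun j => `|(F x - H x - (F y - H y)) j.1 j.2|) (0, i)).
  rewrite (_ : (F x - H x - (F y - H y)) 0 i
    = (F x - H x) 0 i - (F y - H y) 0 i); last by rewrite !mxE.
  have : (F x - H x) 0 i - (F y - H y) 0 i \is a Num.int by rewrite rpredB.
  move=> /intrP[m ->]; rewrite -intr_norm (ltr_int _ _ 1) intr_eq0.
  by case: m => // [[|m]].
apply/row_matrixP => i.
apply: (etrans (row_jacobian i dF)).
apply: (etrans _ (esym (row_jacobian i dH))).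
rewrite (near_eq_derive (delta_mx 0 i : 'rV[R]_d) nFH).
have dc : derivable (cst (F x - H x) : 'rV[R]_d -> 'rV[R]_d) x (delta_mx 0 i).
  exact: derivable_cst.
have dH1 : derivable H x (delta_mx 0 i) by exact: diff_derivable.
by rewrite (deriveD dH1 dc) derive_cst addr0.
Unshelve. all: by end_near. Qed.

Section tdiff_lift.
Variables (G : 'rV[R]_d -> 'rV[R]_d).
Hypothesis eG : equivariant G.
Hypothesis dG : forall x, differentiable G x.

Lemma tdiff_at_lift x : tdiff_at (torus_map G) (proj x) (jacobian G x).
Proof.
exists x, G; split=> //.
by near=> y; rewrite torus_map_proj.
Unshelve. all: by end_near. Qed.

(** [G] and [y |-> G (y + k)] are two lifts of the same torus map, so their Jacobians agree by
    [jacobian_lift_unique]. *)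
Lemma jacobian_equivariant x k : intvec k ->
  jacobian G (x + k) = jacobian G x.
Proof.
move=> hk; pose s := fun y : 'rV[R]_d => y + k.
have dsx : differentiable s x by [].
have dGk : differentiable (G \o s) x by apply: differentiable_comp => //; exact: dG.
have e v : 'D_v (G \o s) x = 'D_v G (x + k).
  suff es : (fun h : R => h^-1 *: ((G \o s \o shift x) (h *: v) - (G \o s) x)) =
      (fun h : R => h^-1 *: ((G \o shift (x + k)) (h *: v) - G (x + k))).
    by rewrite /derive es.
  by apply/funext => h /=; rewrite /s addrA.
transitivity (jacobian (G \o s) x).
  apply/row_matrixP => i; apply: (etrans (row_jacobian i (dG (x + k)))).
  apply: (etrans _ (esym (row_jacobian i dGk))).
  by rewrite e.
apply: jacobian_lift_unique => //.
by near=> y => /=; apply/torus_projP; exact: eG.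
Unshelve. all: by end_near. Qed.

Lemma tdiff_lift x : tdiff (torus_map G) (proj x) = jacobian G x.
Proof.
apply: xget_unique; first exact: tdiff_at_lift.
move=> A [y [F [yx FG dF <-]]].
transitivity (jacobian G y).
  apply: jacobian_lift_unique => //; near=> z.
  by rewrite -(torus_map_proj z eG); near: z.
have /torus_projP hk := yx.
have -> : y = x + (y - x) by rewrite addrC subrK.
exact: jacobian_equivariant.
Unshelve. all: by end_near. Qed.

Lemma C1_lift : continuous (jacobian G) -> C1 (torus_map G).
Proof.
move=> cG; split=> [p|].
  by exists (jacobian G (repr p)); rewrite -{1}(torus_proj_repr p); exact: tdiff_at_lift.
apply: torus_continuousP.
by rewrite (_ : _ \o _ = jacobian G)//; apply/funext => x /=; rewrite tdiff_lift.
Qed.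

End tdiff_lift.

Lemma measurable_torus_continuous (f : T -> R) : continuous f -> measurable_fun setT f.
Proof.
move=> /continuousP cf; apply: (measurability _ (measurable_realfun.RGenOpens.measurableE R)).
move=> _ [_ [a [b ->] <-]]; rewrite setTI.
by apply: sub_sigma_algebra; apply: cf; exact: interval_open.
Qed.

Lemma fundamental_domain (x : 'rV[R]_d) :
  exists2 k, intvec k & forall i, `[0, 1]%classic ((x + k) 0 i).
Proof.
exists (\row_i (- (Num.floor (x 0 i))%:~R)) => i.
  by rewrite mxE rpredN; exact: intr_int.
rewrite !mxE/= in_itv/= subr_ge0 floor_le/=.
by rewrite lerBlDr addrC -(intrD _ _ 1) ltW// floorD1_gt.
Qed.

(** An integer translation brings [x] into the compact unit cube. The point [y] is left free, so
    pairs that straddle a face of the cube need no special treatment. *)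
Lemma torus_unif_continuous (f : T -> R) : continuous f ->
  forall e, 0 < e -> exists2 del, 0 < del &
    forall x y : 'rV[R]_d, (forall i, `|x 0 i - y 0 i| < del) ->
      `|f (proj x) - f (proj y)| < e.
Proof.
move=> cf e e0; pose h := f \o proj.
have ch : continuous h.
  by move=> x; apply: continuous_comp; [exact: torus_proj_continuous|exact: cf].
pose K : set 'rV[R]_d := [set v | forall i, `[0, 1]%classic (v 0 i)].
have cK : compact K.
  by apply: (@rV_compact R d (fun=> `[0, 1]%classic)) => i; exact: segment_compact.
(* The parameter of the covering property is the radius, along the filter of small positive
   reals. *)
have /compact_near_coveringP/(_ R (0^'+) (fun del x => forall y : 'rV[R]_d,
   (forall i, `|x 0 i - y 0 i| < del) -> `|h x - h y| < e)) := cK.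
move=> /(_ _)[].
  move=> x Kx; have e20 : 0 < e / 2 by rewrite divr_gt0.
  have /cvgrPdist_lt/(_ _ e20) := ch x.
  move=> /nbhs_ballP[del /= del0 hdel].
  exists (ball x (del / 2), [set t | 0 < t < del / 2]) => /=.
    split; first by apply: nbhsx_ballx; rewrite divr_gt0.
    by near=> t; apply/andP; split; near: t;
      [exact: nbhs_right_gt|apply: nbhs_right_lt; rewrite divr_gt0].
  move=> [z t] /= [xz /andP[t0 td]] y zy.
  have xzd i : `|x 0 i - z 0 i| < del / 2.
    by have := xz => -[] _ /(_ 0 i); rewrite /ball/=.
  rewrite -(subrKA (h x)) (le_lt_trans (ler_normD _ _))// [ltRHS]splitr ltrD//.
    rewrite distrC; apply: hdel; split=> // j i; rewrite (ord1 j) /ball/=.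
    by rewrite (lt_trans (xzd i))// ltr_pdivrMr// ltr_pMr// ltr1n.
  apply: hdel; split=> // j i; rewrite (ord1 j) /ball/=.
  rewrite -(subrKA (z 0 i)) (le_lt_trans (ler_normD _ _))// [ltRHS]splitr ltrD//.
  by rewrite (lt_trans (zy i)).
move=> del /= del0; have : 0 < del / 2 by rewrite divr_gt0.
move=> d2 hd; exists (del / 2) => // x y xy.
have [k hk xk] := fundamental_domain x.
rewrite -(torus_projD x hk) -(torus_projD y hk).
have := hd (del / 2); apply => //=.
- by rewrite sub0r normrN gtr0_norm// ltr_pdivrMr// ltr_pMr// ltr1n.
- by move=> i; rewrite !mxE opprD addrACA subrr addr0.
Unshelve. all: by end_near. Qed.

Lemma torus_bounded (f : T -> R) : continuous f ->
  exists M : R, forall p, `|f p| <= M.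
Proof.
move=> cf; have [del del0 hdel] := torus_unif_continuous cf ltr01.
pose K : set 'rV[R]_d := [set v | forall i, `[0, 1]%classic (v 0 i)].
have cK : compact K.
  by apply: (@rV_compact R d (fun=> `[0, 1]%classic)) => i; exact: segment_compact.
have ch : continuous (f \o proj).
  by move=> x; apply: continuous_comp; [exact: torus_proj_continuous|exact: cf].
have /compact_bounded[M [_ hM]] : compact ((f \o proj) @` K).
  by apply: continuous_compact => //; exact: continuous_subspaceT.
exists (M + 1) => p; apply: hM; first by rewrite ltrDl.
have [k hk xk] := fundamental_domain (repr p).
by exists (repr p + k) => //=; rewrite torus_projD// torus_proj_repr.
Qed.

End TorusTheory.

(** * Circle maps with neutral semistable fixed points *)

Section CircleMap.
Variable R : realType.
Implicit Types (u s x y : R) (n l : nat) (m : int).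

Lemma cosD2piz x m : cos (x + pi *+ 2 * m%:~R) = cos x.
Proof.
case: m => n; first by rewrite -pmulrn mulr_natr (periodicn (@cosD2pi R)).
rewrite NegzE intrN -pmulrn mulrN mulr_natr.
by rewrite -[in RHS](subrK (pi *+ 2 *+ n.+1) x) (periodicn (@cosD2pi R)).
Qed.

Lemma sinD2piz x m : sin (x + pi *+ 2 * m%:~R) = sin x.
Proof. by rewrite -!cosBpihalf addrAC cosD2piz. Qed.

(** The added term is the primitive of [sin (2 pi u) / 2] that vanishes at the integers. It is
    nonnegative with double zeros there, whence fixed points of slope 1. *)
Definition bumpf u : R := u + (1 - cos (pi *+ 2 * u)) / (pi *+ 4).
Definition dbumpf u : R := 1 + sin (pi *+ 2 * u) / 2.

Lemma bumpf_derive u : is_derive u 1 bumpf (dbumpf u).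
Proof.
rewrite /bumpf /dbumpf.
apply: is_derive_eq.
have p0 : (pi : R) != 0 by rewrite gt_eqF ?pi_gt0.
rewrite /GRing.scale/=.
move: (sin _) (cos _) => a b; move: (pi : R) p0 => p p0.
rewrite -(mulr_natr p 2) -(mulr_natr p 4); field; exact: p0.

Qed.

Lemma dbumpf_ge u : 1 / 2 <= dbumpf u.
Proof. by rewrite /dbumpf; have := sin_geN1 (pi *+ 2 * u); lra. Qed.

Lemma dbumpf_le u : dbumpf u <= 3 / 2.
Proof. by rewrite /dbumpf; have := sin_le1 (pi *+ 2 * u); lra. Qed.

Lemma dbumpf_gt0 u : 0 < dbumpf u.
Proof. by apply: lt_le_trans (dbumpf_ge u); lra. Qed.

Lemma dbumpf_int m : dbumpf m%:~R = 1.
Proof.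
by rewrite /dbumpf -[pi *+ 2 * _]add0r sinD2piz sin0 mul0r addr0.
Qed.

Lemma dbumpf_continuous : continuous dbumpf.
Proof.
move=> u; rewrite /dbumpf; apply: cvgD; first exact: cvg_cst.
apply: cvgM; last exact: cvg_cst.
apply: (@continuous_comp _ _ _ (fun t : R => pi *+ 2 * t) (@sin R)); last exact: continuous_sin.
by apply: cvgM; [exact: cvg_cst|exact: cvg_id].
Qed.

Lemma bumpfDz u m : bumpf (u + m%:~R) = bumpf u + m%:~R.
Proof. by rewrite /bumpf mulrDr cosD2piz addrAC. Qed.

Lemma bumpf_ge u : u <= bumpf u.
Proof.
rewrite /bumpf lerDl; apply: divr_ge0; first by rewrite subr_ge0 cos_le1.
by rewrite mulrn_wge0// pi_ge0.
Qed.

Lemma bumpf_le u : bumpf u <= u + 1.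
Proof.
have p4 : 0 < (pi : R) *+ 4 by rewrite pmulrn_lgt0// pi_gt0.
rewrite /bumpf lerD2l (ler_pdivrMr _ _ p4) mul1r.
have := @pi_ge2 R; have := cos_geN1 (pi *+ 2 * u).
by move: (cos _) => a; move: (pi : R) => p; rewrite -(mulr_natr p 4); lra.
Qed.

Lemma bumpf_eq_cos u : bumpf u = u -> cos (pi *+ 2 * u) = 1.
Proof.
rewrite /bumpf => /eqP; rewrite -subr_eq0 addrAC subrr add0r mulf_eq0 subr_eq0.
rewrite invr_eq0 mulrn_eq0/= (gt_eqF (@pi_gt0 R)) orbF.
by move=> /eqP ->.
Qed.

Lemma bumpf_int m : bumpf m%:~R = m%:~R.
Proof.
by rewrite -[m%:~R]add0r bumpfDz /bumpf mulr0 cos0 subrr mul0r !addr0.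
Qed.

Lemma bumpf_continuous : continuous bumpf.
Proof.
move=> u; apply/differentiable_continuous/derivable1_diffP.
by have [] := bumpf_derive u.
Qed.

Lemma bumpf_mono : {mono bumpf : x y / x <= y}.
Proof.
apply: le_mono => x y xy.
have [z _ h] : exists2 c, c \in `]x, y[ & bumpf y - bumpf x = dbumpf c * (y - x).
  apply: MVT => //; first by move=> t _; exact: bumpf_derive.
  by apply: continuous_subspaceT; exact: bumpf_continuous.
by rewrite -subr_gt0 h mulr_gt0 ?subr_gt0// dbumpf_gt0.
Qed.

Lemma bumpf_inj : injective bumpf.
Proof. exact: inc_inj bumpf_mono. Qed.

(** The displacement lies between 0 and 1, so [[y - 1, y]] brackets a preimage of [y]. *)
Lemma bumpf_surj y : exists x, bumpf x = y.
Proof.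
have [|||c _ <-] := @IVT R bumpf (y - 1) y y; last by exists c.
- by rewrite lerBlDr lerDl.
- by apply: continuous_subspaceT; exact: bumpf_continuous.
- apply/andP; split; rewrite ?ge_min ?le_max.
    by rewrite (le_trans (bumpf_le _))// subrK.
  by rewrite bumpf_ge orbT.
Qed.

Definition bumpg y : R := projT1 (cid (bumpf_surj y)).

Lemma bumpgK : cancel bumpg bumpf.
Proof. by move=> y; rewrite /bumpg; case: cid. Qed.

Lemma bumpfK : cancel bumpf bumpg.
Proof. by move=> x; apply: bumpf_inj; rewrite bumpgK. Qed.

Lemma bumpg_derive y : is_derive y 1 bumpg (dbumpf (bumpg y))^-1.
Proof.
have h : is_derive (bumpf (bumpg y)) 1 bumpg (dbumpf (bumpg y))^-1.
  apply: is_derive_inverse.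
  - by near=> z; exact: bumpfK.
  - by near=> z; exact: bumpf_continuous.
  - exact: bumpf_derive.
  - by rewrite gt_eqF// dbumpf_gt0.
by rewrite bumpgK in h.
Unshelve. all: by end_near. Qed.

Lemma bumpg_continuous : continuous bumpg.
Proof.
move=> u; apply/differentiable_continuous/derivable1_diffP.
by have [] := bumpg_derive u.
Qed.

Lemma bumpgDz y m : bumpg (y + m%:~R) = bumpg y + m%:~R.
Proof. by apply: bumpf_inj; rewrite bumpgK bumpfDz bumpgK. Qed.

(** The orbit increases and cannot cross the fixed point [ceil u]. Its limit is a fixed point, and
    the fixed points are integers. *)
Lemma iter_bumpf_cvg u : iter n bumpf u @[n --> \oo] --> ((Num.ceil u)%:~R : R).
Proof.
pose v n := iter n bumpf u.
have vS n : v n.+1 = bumpf (v n) by [].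
have nd : nondecreasing_seq v by apply/nondecreasing_seqP => n; exact: bumpf_ge.
have ub n : v n <= (Num.ceil u)%:~R.
  elim: n => [|n ih]; first exact: ceil_ge.
  by rewrite vS -(bumpf_int (Num.ceil u)) bumpf_mono.
have cv : cvgn v.
  by apply: nondecreasing_is_cvgn => //; exists (Num.ceil u)%:~R => _ [n _ <-].
pose L := limn v.
have Lub : L <= (Num.ceil u)%:~R by apply: limr_le => //; near=> n.
have Llb : u <= L by apply: (nondecreasing_cvgn_le nd cv 0).
have fix_ : bumpf L = L.
  have h1 : v n.+1 @[n --> \oo] --> L by rewrite cvg_shiftS; exact: cv.
  have h2 : v n.+1 @[n --> \oo] --> bumpf L.
    by apply: (@continuous_cvg _ _ _ _ _ v bumpf); [exact: bumpf_continuous|exact: cv].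
  by apply/esym; apply: cvg_unique h1 h2.
suff -> : (Num.ceil u)%:~R = L by exact: cv.
apply/eqP; rewrite eq_le Lub andbT leNgt; apply/negP => Llt.
have := bumpf_eq_cos fix_.
(* Here [L] would lie strictly between consecutive integers, so [t] is in []0, 1[], where
   [1 - cos (2 pi t) = 2 sin (pi t) ^ 2] is positive. *)
pose t := L - (Num.ceil u - 1)%:~R.
have t0 : 0 < t by rewrite subr_gt0 (lt_le_trans (ceilB1_lt u)).
have t1 : t < 1 by rewrite /t intrB; lra.
have -> : L = t + (Num.ceil u - 1)%:~R by rewrite subrK.
rewrite mulrDr cosD2piz.
have -> : pi *+ 2 * t = (pi * t) *+ 2 by rewrite mulrnAl.
rewrite cos_mulr2n cos2sin2.
have st : 0 < sin (pi * t).
  by apply: sin_gt0_pi; rewrite mulr_gt0 ?pi_gt0//= gtr_pMr ?pi_gt0.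
have := exprn_gt0 2 st; lra.
Unshelve. all: by end_near. Qed.

Lemma iter_dbumpf_cvg u : dbumpf (iter n bumpf u) @[n --> \oo] --> (1 : R).
Proof.
rewrite -(dbumpf_int (Num.ceil u)).
by apply: continuous_cvg; [exact: dbumpf_continuous|exact: iter_bumpf_cvg].
Qed.

End CircleMap.

(** * A law of large numbers *)

Section BoundedMeasurable.
Context d (T : measurableType d) (R : realType) (P : probability T R).
Implicit Types f g : T -> R.

(** A class closed under sums and products on which the real-valued integral is linear, [P] being
    finite; integrability then needs no separate check. *)
Definition bmfun f := measurable_fun setT f /\ exists M : R, forall x, `|f x| <= M.

Lemma bmfun_cst (c : R) : bmfun (fun=> c).
Proof. by split; [exact: measurable_cst | exists `|c|]. Qed.

Lemma bmfunD f g : bmfun f -> bmfun g -> bmfun (fun x => f x + g x).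
Proof.
move=> [mf [M hM]] [mg [N hN]]; split; first exact: measurable_funD.
by exists (M + N) => x; apply: le_trans (ler_normD _ _) _; exact: lerD.
Qed.

Lemma bmfunM f g : bmfun f -> bmfun g -> bmfun (fun x => f x * g x).
Proof.
move=> [mf [M hM]] [mg [N hN]]; split; first exact: measurable_funM.
by exists (M * N) => x; rewrite normrM ler_pM.
Qed.

Lemma bmfun_sum I (r : seq I) (F : I -> T -> R) :
  (forall i, bmfun (F i)) -> bmfun (fun x => \sum_(i <- r) F i x).
Proof.
move=> bF; elim: r => [|i r ih].
  by under eq_fun do rewrite big_nil; exact: bmfun_cst.
by under eq_fun do rewrite big_cons; exact: bmfunD.
Qed.

Lemma bmfun_integrable f : bmfun f -> P.-integrable setT (EFin \o f).
Proof.
move=> [mf [M hM]]; apply: measurable_bounded_integrable => //.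
  by apply: le_lt_trans (probability_le1 P measurableT) _; rewrite ltry.
exists M; split; first exact: num_real.
by move=> N MN x _; apply: le_trans (hM x) (ltW MN).
Qed.

Lemma Rint_cst (c : R) : \int[P]_x c = c.
Proof. by rewrite Rintegral_cst// [X in fine X](probability_setT P)/= mulr1. Qed.

Lemma RintD f g : bmfun f -> bmfun g ->
  \int[P]_x (f x + g x) = \int[P]_x f x + \int[P]_x g x.
Proof. by move=> /bmfun_integrable bf /bmfun_integrable bg; rewrite RintegralD. Qed.

Lemma RintZ (c : R) f : bmfun f -> \int[P]_x (c * f x) = c * \int[P]_x f x.
Proof. by move=> /bmfun_integrable bf; rewrite RintegralZl. Qed.

Lemma Rint_sum I (r : seq I) (F : I -> T -> R) : (forall i, bmfun (F i)) ->
  \int[P]_x (\sum_(i <- r) F i x) = \sum_(i <- r) \int[P]_x F i x.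
Proof.
move=> bF; elim: r => [|i r ih].
  by rewrite big_nil; under eq_Rintegral do rewrite big_nil; rewrite Rint_cst.
rewrite big_cons; under eq_Rintegral do rewrite big_cons.
by rewrite RintD ?ih//; exact: bmfun_sum.
Qed.

Lemma Rint_le f g : bmfun f -> bmfun g -> (forall x, f x <= g x) ->
  \int[P]_x f x <= \int[P]_x g x.
Proof.
by move=> /bmfun_integrable bf /bmfun_integrable bg fg; apply: le_Rintegral.
Qed.

End BoundedMeasurable.

Lemma nat_sqrt_floor n : exists q, (q ^ 2 <= n < q.+1 ^ 2)%N.
Proof.
elim: n => [|n [q /andP[qn nq]]]; first by exists 0%N.
have [h|h] := leqP (q.+1 ^ 2) n.+1.
  by exists q.+1; rewrite h/=; apply: leq_ltn_trans nq _; rewrite ltn_exp2r.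
by exists q; rewrite h (leq_trans qn).
Qed.

(** The term [n^-1] closes the induction, as [1 / (n + 1) ^ 2 <= 1 / n - 1 / (n + 1)]. The case
    [n = 0] rests on the convention [0^-1 = 0], and [n = 1] is treated apart. *)
Lemma sum_inv_sqr_le (R : realType) n :
  \sum_(k < n) (k.+1%:R ^+ 2)^-1 <= 2 - n%:R^-1 :> R.
Proof.
elim: n => [|n ih]; first by rewrite big_ord0 invr0; lra.
rewrite big_ord_recr/=; case: n ih => [|n] ih.
  by rewrite big_ord0 expr1n invr1; lra.
apply: le_trans (lerD ih (lexx _)) _.
have h1 : 0 < n.+1%:R :> R by rewrite ltr0n.
have -> : n.+2%:R = n.+1%:R + 1 :> R by rewrite -natr1.
move: (n.+1%:R) h1 => x x0.
have x1 : 0 < x + 1 by lra.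
rewrite -subr_ge0.
have -> : 2 - (x + 1)^-1 - (2 - x^-1 + ((x + 1) ^+ 2)^-1) =
  (x * (x + 1) ^+ 2)^-1.
  by field; rewrite !gt_eqF.
by rewrite invr_ge0 mulr_ge0 ?sqr_ge0// ltW.
Qed.

Section SLLN.
Context d (T : measurableType d) (R : realType) (P : probability T R).
Variable X : nat -> T -> R.
Hypothesis mX : forall j, measurable_fun setT (X j).
Hypothesis X1 : forall j x, `|X j x| <= 1.
Hypothesis X0 : forall i j, (i < j)%N -> \int[P]_x (X i x * X j x) = 0.

Let S n x := \sum_(j < n) X j x.

Let bX j : bmfun (X j). Proof. by split=> //; exists 1. Qed.

Let bS n : bmfun (S n). Proof. exact: bmfun_sum. Qed.

(** The cross terms vanish by orthogonality and each diagonal term is at most 1. *)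
Let ES n : \int[P]_x (S n x * S n x) <= n%:R.
Proof.
elim: n => [|n ih].
  by under eq_Rintegral do rewrite /S big_ord0 mulr0; rewrite Rint_cst.
have -> : \int[P]_x (S n.+1 x * S n.+1 x) =
    \int[P]_x (S n x * S n x) + 2 * \int[P]_x (\sum_(j < n) X j x * X n x) +
    \int[P]_x (X n x * X n x).
  have b1 := bmfunM (bS n) (bS n).
  have b2 : bmfun (fun x => \sum_(j < n) X j x * X n x).
    by apply: bmfun_sum => i; exact: bmfunM.
  have b3 : bmfun (fun x => 2 * \sum_(j < n) X j x * X n x).
    by apply: bmfunM; first exact: bmfun_cst.
  rewrite -RintZ// -(RintD _ b1 b3) -(RintD _ (bmfunD b1 b3) (bmfunM (bX n) (bX n))).
  apply: eq_Rintegral => x _.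
  by rewrite -mulr_suml /S big_ord_recr/=; ring.
rewrite (_ : \int[P]_x (\sum_(j < n) X j x * X n x) = 0); last first.
  rewrite Rint_sum; last by move=> i; exact: bmfunM.
  by rewrite big1// => i _; exact: X0.
rewrite mulr0 addr0 -natr1 lerD//.
rewrite -[leRHS](Rint_cst P 1); apply: Rint_le.
- exact: bmfunM.
- exact: bmfun_cst.
- move=> x; apply: le_trans (ler_norm _) _.
  by rewrite normrM -[leRHS]mulr1 ler_pM.
Qed.

(* The squared average at time [n = k.+1 ^ 2]; the averages at other times are compared
   with these in [slln_orthogonal]. *)
Let Y k x := (k.+1%:R ^+ 2)^-1 * (k.+1%:R ^+ 2)^-1 *
  (S (k.+1 ^ 2) x * S (k.+1 ^ 2) x).

Let Y_ge0 k x : 0 <= Y k x.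
Proof. by rewrite /Y mulr_ge0// -expr2 sqr_ge0. Qed.

Let bY k : bmfun (Y k).
Proof. by apply: bmfunM; [exact: bmfun_cst|exact: bmfunM]. Qed.

Let EY k : \int[P]_x Y k x <= (k.+1%:R ^+ 2)^-1.
Proof.
have q0 : 0 < k.+1%:R ^+ 2 :> R by rewrite exprn_gt0// ltr0n.
rewrite /Y RintZ; last exact: bmfunM.
rewrite -mulrA ler_piMr ?invr_ge0 ?(ltW q0)// mulrC ler_pdivrMr// mul1r.
by apply: le_trans (ES _) _; rewrite natrX.
Qed.

(** Sum and integral are exchanged, and the means are dominated by the inverse squares. *)
Let Ysum : (\int[P]_x (\sum_(0 <= k <oo) (Y k x)%:E) < +oo)%E.
Proof.
rewrite integral_nneseries//; last 2 first.
- by move=> k; apply/measurable_EFinP; exact: (bY k).1.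
- by move=> k x _; rewrite lee_fin.
apply: (@le_lt_trans _ _ 2%:E); last by rewrite ltry.
have EYE k : (\int[P]_x (Y k x)%:E = (\int[P]_x Y k x)%:E)%E.
  rewrite /Rintegral fineK//; apply: integrable_fin_num => //.
  exact: bmfun_integrable.
apply: lime_le.
  by apply: is_cvg_nneseries => n _ _; apply: integral_ge0 => x _; rewrite lee_fin.
near=> n.
under eq_bigr do rewrite EYE.
rewrite big_mkord sumEFin lee_fin.
apply: le_trans (ler_sum _ (fun (k : 'I_n) _ => EY k)) _.
apply: le_trans (sum_inv_sqr_le _ _) _.
by rewrite gerBl invr_ge0.
Unshelve. all: by end_near. Qed.

(** A nonnegative series with finite mean is finite almost everywhere, so its terms tend to 0. *)
Let Y_cvg0 : {ae P, forall x, Y k x @[k --> \oo] --> 0}.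
Proof.
have iY : P.-integrable setT (fun x => \sum_(0 <= k <oo) (Y k x)%:E)%E.
  apply/integrableP; split.
    apply: ge0_emeasurable_sum => [k x _ _|k _]; first by rewrite lee_fin.
    by apply/measurable_EFinP; exact: (bY k).1.
  under eq_integral => x _.
    rewrite gee0_abs; last by apply: nneseries_ge0 => k _ _; rewrite lee_fin.
    over.
  exact: Ysum.
have := integrable_ae measurableT iY; apply: filterS => x /(_ Logic.I) fx.
apply: cvg_series_cvg_0.
apply: nondecreasing_is_cvgn.
  by apply/nondecreasing_seqP => n; rewrite /series/= big_nat_recr//= lerDl.
exists (fine (\sum_(0 <= k <oo) (Y k x)%:E)%E) => _ [n _ <-].
rewrite /series/= -lee_fin fineK// -sumEFin.
by apply: nneseries_lim_ge => k _ _; rewrite lee_fin.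
Qed.

(** If [q ^ 2 <= n < (q + 1) ^ 2], then [S n] and [S (q ^ 2)] differ by at most [2 q] terms of size
    at most 1, which is negligible against [n >= q ^ 2]. *)
Lemma slln_orthogonal :
  {ae P, forall x, n%:R^-1 * (\sum_(j < n) X j x) @[n --> \oo] --> 0}.
Proof.
have := Y_cvg0; apply: filterS => x cY.
apply/cvgrPdist_le => e e0.
have e2 : 0 < (e / 2) ^+ 2 by rewrite exprn_gt0// divr_gt0.
have /cvgrPdist_le/(_ _ e2)[K _ hK] := cY.
(* [Q] is large enough that [q - 1 >= K], where [q - 1] is the index of [Y] for time [q ^ 2], and
   that [q >= 4 / e], which gives [2 q <= e / 2 * q ^ 2]. *)
pose Q := (maxn K (Num.truncn (4 / e))).+2.
exists (Q ^ 2)%N => // n /= Qn.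
have [q /andP[qn nq]] := nat_sqrt_floor n.
have Qq : (Q <= q)%N.
  rewrite leqNgt; apply/negP => qQ.
  have : (q.+1 ^ 2 <= Q ^ 2)%N by rewrite leq_exp2r.
  by move=> h; have := leq_trans nq h; rewrite ltnNge Qn.
rewrite sub0r normrN normrM normfV normr_nat.
have n0 : 0 < n%:R :> R by rewrite ltr0n (leq_trans _ Qn)// expn_gt0.
rewrite mulrC ler_pdivrMr//.
rewrite -/(S n x).
have Sle : `|S n x| <= `|S (q ^ 2) x| + (n - q ^ 2)%:R.
  have -> : S n x = S (q ^ 2) x + \sum_(q ^ 2 <= j < n) X j x.
    by rewrite /S -!(big_mkord xpredT (X ^~ x)) -big_cat_nat.
  apply: le_trans (ler_normD _ _) _; rewrite lerD2l.
  apply: le_trans (ler_norm_sum _ _ _) _.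
  apply: (@le_trans _ _ (\sum_(q ^ 2 <= j < n) (1 : R))); first exact: ler_sum.
  by rewrite big_const_nat iter_addr_0.
have q1 : (0 < q)%N by apply: leq_trans Qq.
have q0 : 0 < q%:R :> R by rewrite ltr0n.
have Sq : `|S (q ^ 2) x| <= e / 2 * q%:R ^+ 2.
  have := hK q.-1; rewrite /= /Y prednK// => /(_ _).
  have Kq : (K <= q.-1)%N by rewrite -ltnS prednK// (leq_trans _ Qq)// /Q ltnS ltnW// ltnS leq_maxl.
  move=> /(_ Kq); rewrite sub0r normrN.
  rewrite -!expr2 -exprMn normrX ler_pXn2r ?nnegrE//; last by rewrite divr_ge0// ltW.
  by rewrite normrM ger0_norm ?invr_ge0 ?sqr_ge0// mulrC ler_pdivrMr// exprn_gt0.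
apply: le_trans Sle _.
have nq2 : (n - q ^ 2 <= 2 * q)%N.
  by rewrite leq_subLR -ltnS (leq_trans nq)// -addn1 sqrnD; lia.
have qe : 4 / e <= q%:R.
  apply: le_trans (ltW (truncnS_gt _)) _; rewrite ler_nat (leq_trans _ Qq)// /Q.
  by rewrite ltnS ltnW// ltnS leq_maxr.
have hq2 : (2 * q)%:R <= e / 2 * q%:R ^+ 2.
  move: qe; rewrite ler_pdivrMr// natrM => qe.
  by have := ler_wpM2r (ltW q0) qe; rewrite expr2; lra.
have qn' : q%:R ^+ 2 <= n%:R :> R by rewrite -natrX ler_nat.
have nq2' : (n - q ^ 2)%:R <= (2 * q)%:R :> R by rewrite ler_nat.
have := ler_wpM2l (ltW e0) qn'; lra.
Qed.

End SLLN.

Lemma cesaro_avg (R : realType) (u : nat -> R) (a : R) : u n @[n --> \oo] --> a ->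
  n%:R^-1 * (\sum_(j < n) u j) @[n --> \oo] --> a.
Proof.
move=> cu; rewrite -cvg_shiftS.
rewrite (_ : (fun n => _) = arithmetic_mean u); first exact: cesaro.
by apply/funext => n; rewrite /arithmetic_mean/= /series/= big_mkord.
Qed.

Lemma ln_prod (R : realType) n (u : nat -> R) : (forall j, 0 < u j) ->
  ln (\prod_(j < n) u j) = \sum_(j < n) ln (u j).
Proof.
move=> u0; elim: n => [|n ih]; first by rewrite !big_ord0 ln1.
by rewrite !big_ord_recr/= lnM ?posrE ?ih ?prodr_gt0.
Qed.

(** * Characters along the orbits of the cat map *)

Section SquareMeasure.
Variable R : realType.

Definition circle_prob : probability (measurableTypeR R) R := uniform_prob (@ltr01 R).

Definition square_prob : probability (measurableTypeR R * measurableTypeR R)%type R :=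
  (circle_prob \x circle_prob)%E.

Lemma square_prob_filter : Filter (almost_everywhere square_prob).
Proof. exact: (ae_filter_ringOfSetsType square_prob). Qed.

#[local] Existing Instance square_prob_filter.

Lemma measurable_cos : measurable_fun setT (@cos R).
Proof. by apply: continuous_measurable_fun; exact: continuous_cos. Qed.

(** Real characters with a phase: cosines and sines form one family, and products of waves stay in
    its span. *)
Definition wave (m n : int) (c : R) (z : R * R) : R :=
  cos (pi *+ 2 * (m%:~R * z.1 + n%:~R * z.2) + c).

Lemma bmfun_cos d (T : measurableType d) (f : T -> R) : measurable_fun setT f ->
  bmfun (fun x => cos (f x)).
Proof.
move=> mf; split; last by exists 1 => x; exact: cos_max.
exact: measurableT_comp measurable_cos mf.
Qed.

Lemma bmfun_wave m n c : bmfun (wave m n c).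
Proof.
apply: bmfun_cos; apply: measurable_funD => //; apply: measurable_funM => //.
by apply: measurable_funD; apply: measurable_funM.
Qed.

Lemma bmfun_wave1 (m : int) (c : R) : bmfun (fun x : R => cos (pi *+ 2 * (m%:~R * x) + c)).
Proof.
by apply: bmfun_cos; apply: measurable_funD => //; apply: measurable_funM => //;
   apply: measurable_funM.
Qed.

Lemma Rint_wave1 (m : int) (c : R) : m != 0 ->
  \int[circle_prob]_x cos (pi *+ 2 * (m%:~R * x) + c) = 0.
Proof.
move=> m0; pose f (x : R) : R := cos (pi *+ 2 * (m%:~R * x) + c).
rewrite -[LHS]/(\int[circle_prob]_x f x).
have bf : @bmfun _ (measurableTypeR R) R f by exact: bmfun_wave1.
have p0 : pi *+ 2 * m%:~R != 0 :> R.
  by rewrite mulf_neq0 ?intr_eq0// mulrn_eq0/= gt_eqF// pi_gt0.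
(* [F] is a primitive of [1 + f] rather than of [f]: the formula for integrals against the uniform
   law asks for a nonnegative integrand. *)
pose F x := x + sin (pi *+ 2 * (m%:~R * x) + c) / (pi *+ 2 * m%:~R).
have dF (x : R) : is_derive x 1 F (1 + f x : R).
  rewrite /F /f; apply: is_derive_eq; rewrite /GRing.scale/=.
  move: p0; move: (sin _) (cos _) => a b; move: (pi *+ 2 : R) => p p0.
  move: p0; rewrite mulf_eq0 negb_or => /andP[p0 m1].
  field; by rewrite p0 m1.
have cf : continuous f.
  move=> x; apply: continuous_comp; last exact: continuous_cos.
  apply: cvgD; last exact: cvg_cst.
  by apply: cvgM; [exact: cvg_cst|apply: cvgM; [exact: cvg_cst|exact: cvg_id]].
have cF : continuous F.
  move=> x; apply/differentiable_continuous/derivable1_diffP.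
  by have [] := dF x.
have h : (\int[circle_prob]_x (1 + f x)%:E = 1)%E.
  rewrite integral_uniform/=; last 2 first.
  - by apply/measurable_EFinP; apply: measurable_funD => //; exact: bf.1.
  - by move=> x; rewrite lee_fin -lerBlDl sub0r cos_geN1.
  rewrite subr0 invr1 mul1e (@continuous_FTC2 _ _ F)//.
  - suff -> : F 1 = F 0 + 1 by rewrite -EFinB addrAC subrr add0r.
    rewrite /F !mulr1 !mulr0 add0r (addrC _ c) sinD2piz add0r.
    by rewrite addrC.
  - apply: continuous_subspaceT => x; apply: cvgD; first exact: cvg_cst.
    exact: cf.
  - split.
    + by move=> x _; have [] := dF x.
    + by apply: cvg_at_right_filter; exact: cF.
    + by apply: cvg_at_left_filter; exact: cF.
  - by move=> x _; rewrite derive1E; have [_ ->] := dF x.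
have : \int[circle_prob]_x (1 + f x) = 1 by rewrite /Rintegral h.
rewrite (RintD _ (bmfun_cst _ 1) bf) Rint_cst => /eqP.
by rewrite -subr_eq0 addrAC subrr add0r => /eqP.
Qed.

Lemma square_prob_fubini (f : R * R -> R) : bmfun f ->
  (forall x, \int[circle_prob]_y f (x, y) = 0) -> \int[square_prob]_z f z = 0.
Proof.
move=> bf f0; rewrite /Rintegral /square_prob -integral12_prod_meas1; last exact: bmfun_integrable.
rewrite (eq_integral (cst 0%E)) ?integral_cst ?mul0e// => x _ /=.
rewrite -[LHS]fineK; first by rewrite [X in X%:E]f0.
apply: integrable_fin_num => //.
have bfx : @bmfun _ (measurableTypeR R) R (fun y => f (x, y)).
  split; first exact: measurableT_comp bf.1 (pair1_measurable _).
  by have [_ [M hM]] := bf; exists M => y.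
exact: (bmfun_integrable circle_prob bfx).
Qed.

Lemma square_prob_fubini2 (f : R * R -> R) : bmfun f ->
  (forall y, \int[circle_prob]_x f (x, y) = 0) -> \int[square_prob]_z f z = 0.
Proof.
move=> bf f0; rewrite /Rintegral /square_prob -integral21_prod_meas1; last exact: bmfun_integrable.
rewrite (eq_integral (cst 0%E)) ?integral_cst ?mul0e// => y _ /=.
rewrite -[LHS]fineK; first by rewrite [X in X%:E]f0.
apply: integrable_fin_num => //.
have bfy : @bmfun _ (measurableTypeR R) R (fun x => f (x, y)).
  split; first exact: measurableT_comp bf.1 (pair2_measurable _).
  by have [_ [M hM]] := bf; exists M => x.
exact: (bmfun_integrable circle_prob bfy).
Qed.

Lemma Rint_wave m n c : (m != 0) || (n != 0) -> \int[square_prob]_z wave m n c z = 0.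
Proof.
move=> mn; have bw := bmfun_wave m n c.
have [n0|n0] := eqVneq n 0.
  rewrite n0 eqxx orbF in mn *; apply: square_prob_fubini2; first exact: bmfun_wave.
  move=> y; rewrite -[RHS](Rint_wave1 c mn); apply: eq_Rintegral => x _.
  by rewrite /wave/= mul0r addr0.
apply: square_prob_fubini => // x.
rewrite -[RHS](Rint_wave1 (pi *+ 2 * (m%:~R * x) + c) n0); apply: eq_Rintegral => y _.
by rewrite /wave/=; congr cos; ring.
Qed.

Lemma waveM m n c m' n' c' z : wave m n c z * wave m' n' c' z =
  2^-1 * (wave (m + m') (n + n') (c + c') z + wave (m - m') (n - n') (c - c') z).
Proof.
rewrite /wave.
have -> : pi *+ 2 * ((m + m')%:~R * z.1 + (n + n')%:~R * z.2) + (c + c') =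
  (pi *+ 2 * (m%:~R * z.1 + n%:~R * z.2) + c) +
  (pi *+ 2 * (m'%:~R * z.1 + n'%:~R * z.2) + c') by rewrite !intrD; ring.
have -> : pi *+ 2 * ((m - m')%:~R * z.1 + (n - n')%:~R * z.2) + (c - c') =
  (pi *+ 2 * (m%:~R * z.1 + n%:~R * z.2) + c) -
  (pi *+ 2 * (m'%:~R * z.1 + n'%:~R * z.2) + c') by rewrite !intrB; ring.
move: (pi *+ 2 * (m%:~R * z.1 + n%:~R * z.2) + c) => a.
move: (pi *+ 2 * (m'%:~R * z.1 + n'%:~R * z.2) + c') => b.
rewrite (cosD a b) (cosB a b); move: (cos a) (sin a) (cos b) (sin b) => ? ? ? ?; by field.
Qed.

Lemma Rint_waveM m n c m' n' c' :
  (m + m' != 0) || (n + n' != 0) -> (m - m' != 0) || (n - n' != 0) ->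
  \int[square_prob]_z (wave m n c z * wave m' n' c' z) = 0.
Proof.
move=> h1 h2; under eq_Rintegral do rewrite waveM.
rewrite RintZ; last by apply: bmfunD; exact: bmfun_wave.
rewrite RintD; [|exact: bmfun_wave..].
by rewrite !Rint_wave// addr0 mulr0.
Qed.

(** Stated over any ring because the same formula moves points of the plane and integer frequencies:
    the matrix is symmetric, so it equals its transpose. *)
Definition catmap (A : pzRingType) (z : A * A) : A * A := (2 * z.1 + z.2, z.1 + z.2).

Lemma wave_catmap (m n : int) c z : wave m n c (catmap z) =
  wave (catmap (m, n)).1 (catmap (m, n)).2 c z.
Proof. by rewrite /wave /catmap/= !intrD intrM; congr cos; ring. Qed.

Lemma wave_iter_catmap (k : int * int) c j z :
  wave k.1 k.2 c (iter j (@catmap R) z) =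
  wave (iter j (@catmap int) k).1 (iter j (@catmap int) k).2 c z.
Proof.
elim: j k => // j ih k; rewrite iterS wave_catmap.
by rewrite -[(k.1, k.2)]/((k.1, k.2)) -surjective_pairing ih -iterSr.
Qed.

(** [golden ^ 2 = golden + 1] and [2 - golden] are the eigenvalues of the cat map, with eigenvectors
    [(golden, 1)] and [(1, - golden)]. *)
Definition golden : R := (1 + Num.sqrt 5) / 2.

Lemma goldenE : golden ^+ 2 = golden + 1.
Proof.
have h : Num.sqrt 5 ^+ 2 = 5 :> R by rewrite sqr_sqrtr.
by rewrite /golden; move: (Num.sqrt 5) h => s h; lra.
Qed.

Lemma golden_gt1 : 3 / 2 < golden.
Proof.
have : 2 < Num.sqrt 5 :> R.
  rewrite -[ltLHS]ger0_norm// -sqrtr_sqr ltr_sqrt//; lra.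
by rewrite /golden; lra.
Qed.

Lemma golden_lt2 : golden < 2.
Proof.
have : Num.sqrt 5 < 3 :> R.
  rewrite -[ltRHS]ger0_norm// -sqrtr_sqr ltr_sqrt//; lra.
by rewrite /golden; lra.
Qed.

(* The orbit of a nonzero integer vector would otherwise be periodic up to sign, and both
   eigenfunctionals [lu] and [ls] would vanish on the vector. *)
Lemma iter_catmap_neq (k : int * int) (i j : nat) : (i < j)%N -> k != (0, 0) ->
  let a := iter i (@catmap int) k in let b := iter j (@catmap int) k in
  ((a.1 + b.1 != 0) || (a.2 + b.2 != 0)) /\ ((a.1 - b.1 != 0) || (a.2 - b.2 != 0)).
Proof.
move=> ij k0 a b.
pose lu (k : int * int) : R := golden * k.1%:~R + k.2%:~R.
pose ls (k : int * int) : R := k.1%:~R - golden * k.2%:~R.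
have g2 := goldenE; have g3 := golden_gt1; have g4 := golden_lt2.
have luE n q : lu (iter n (@catmap int) q) = (golden ^+ 2) ^+ n * lu q.
  elim: n => [|n ih]; first by rewrite expr0 mul1r.
  rewrite iterS exprS -mulrA -ih; move: (iter _ _ _) => [x y].
  rewrite /lu /catmap/= !intrD intrM; move: (x%:~R) (y%:~R) => u v.
  apply/eqP; rewrite -subr_eq0; apply/eqP.
  transitivity ((golden + 1 - golden ^+ 2) * ((golden + 1) * u + v)); first by ring.
  by rewrite g2; ring.
have lsE n q : ls (iter n (@catmap int) q) = (2 - golden) ^+ n * ls q.
  elim: n => [|n ih]; first by rewrite expr0 mul1r.
  rewrite iterS exprS -mulrA -ih; move: (iter _ _ _) => [x y].
  rewrite /ls /catmap/= !intrD intrM; move: (x%:~R) (y%:~R) => u v.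
  have -> : (2 - golden) * (u - golden * v) =
    2 * u - golden * u - 2 * golden * v + golden ^+ 2 * v by ring.
  by rewrite g2; ring.
(* Both [s = 1] and [s = -1] must be excluded, because the product of two waves involves the sum and
   the difference of their frequencies. *)
have key (s : R) : `|s| = 1 -> b.1%:~R = s * a.1%:~R -> b.2%:~R = s * a.2%:~R -> False.
  move=> s1 h1 h2.
  have hu : lu b = s * lu a by rewrite /lu h1 h2; ring.
  have hs : ls b = s * ls a by rewrite /ls h1 h2; ring.
  have contr (t l : R) : t ^+ j * l = s * (t ^+ i * l) -> 0 < t -> t != 1 -> l = 0.
    move=> e t0 t1; apply/eqP; apply: contraTT isT => l0.
    have := congr1 (fun x => `|x|) e.
    rewrite !normrM s1 mul1r !normrX (gtr0_norm t0).
    move=> /(mulIf (_ : `|l| != 0)); rewrite normr_eq0 l0 => /(_ isT).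
    by move=> /(ieexprIn t0 t1) ji; rewrite ji ltnn in ij.
  have lu0 : lu k = 0.
    apply: (contr (golden ^+ 2)); first by rewrite -!luE.
    - by rewrite g2; lra.
    - by rewrite g2 gt_eqF//; lra.
  have ls0 : ls k = 0.
    apply: (contr (2 - golden)); first by rewrite -!lsE.
    - lra.
    - by rewrite lt_eqF//; lra.
  move: k0 lu0 ls0; rewrite /lu /ls; case: (k) => x y /=; rewrite xpair_eqE => xy.
  move=> e1 e2.
  have y0 : y = 0.
    apply/eqP; rewrite -(@intr_eq0 R); apply/eqP.
    have e3 : x%:~R = golden * y%:~R by lra.
    move: e1; rewrite e3 mulrA -expr2 g2 => e1.
    have /eqP : (golden + 2) * y%:~R = 0 by lra.
    by rewrite mulf_eq0 gt_eqF/= => [/eqP//|]; lra.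
  move: xy; rewrite y0 eqxx andbT; move: e2; rewrite y0 mulr0 subr0 => /eqP.
  by rewrite intr_eq0 => /eqP ->; rewrite eqxx.
split; rewrite -negb_and; apply/negP => /andP[/eqP h1 /eqP h2].
  apply: (key (-1)); first by rewrite normrN1.
  - by rewrite mulN1r -intrN; congr (_%:~R); lia.
  - by rewrite mulN1r -intrN; congr (_%:~R); lia.
apply: (key 1); first by rewrite normr1.
- by rewrite mul1r; congr (_%:~R); lia.
- by rewrite mul1r; congr (_%:~R); lia.
Qed.

Definition birkhoff (f : R * R -> R) (z : R * R) (n : nat) : R :=
  n%:R^-1 * \sum_(j < n) f (iter j (@catmap R) z).

Lemma ae_birkhoff_wave (k : int * int) c : k != (0, 0) ->
  {ae square_prob, forall z, birkhoff (wave k.1 k.2 c) z n @[n --> \oo] --> 0}.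
Proof.
move=> k0.
apply: (@slln_orthogonal _ _ R square_prob (fun j z => wave k.1 k.2 c (iter j (@catmap R) z))).
- move=> j; rewrite (_ : (fun z => _) =
    wave (iter j (@catmap int) k).1 (iter j (@catmap int) k).2 c).
    exact: (bmfun_wave _ _ _).1.
  by apply/funext => z; exact: wave_iter_catmap.
- by move=> j z; exact: cos_max.
- move=> i j ij; under eq_Rintegral do rewrite !wave_iter_catmap.
  by have [h1 h2] := iter_catmap_neq ij k0; exact: Rint_waveM.
Qed.

Definition generic_pt (z : R * R) : Prop :=
  forall (k : int * int) c, k != (0, 0) -> birkhoff (wave k.1 k.2 c) z n @[n --> \oo] --> 0.

Lemma ae_generic : {ae square_prob, forall z, generic_pt z}.
Proof.
(* Countably many conditions suffice: the frequencies are enumerated by [pickle], and the phases 0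
   and [- (pi / 2)], that is cosine and sine, span all phases. *)
pose Q (i : nat) (z : R * R) := forall k : int * int, unpickle i = Some k -> k != (0, 0) ->
  birkhoff (wave k.1 k.2 0) z n @[n --> \oo] --> 0 /\
  birkhoff (wave k.1 k.2 (- (pi / 2))) z n @[n --> \oo] --> 0.
have : {ae square_prob, forall z, forall i, Q i z}.
  apply: ae_foralln => i; rewrite /Q.
  case: (unpickle i) => [k|]; last by apply: filterE => z.
  have [->|k0] := eqVneq k (0, 0); first by apply: filterE => z _ [<-].
  have h1 := ae_birkhoff_wave 0 k0.
  have h2 := ae_birkhoff_wave (- (pi / 2)) k0.
  by near=> z => _ [<-] _; split; near: z.
apply: filterS => z h k c k0.
have [h1 h2] := h (pickle k) k (pickleK k) k0.
have -> : birkhoff (wave k.1 k.2 c) z = (fun n => cos c * birkhoff (wave k.1 k.2 0) z n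
   - sin c * birkhoff (wave k.1 k.2 (- (pi / 2))) z n).
  apply/funext => n; rewrite /birkhoff [in RHS]mulrCA [X in _ - X]mulrCA -mulrBr.
  congr (_ * _); rewrite 2!mulr_sumr -sumrB; apply: eq_bigr => j _.
  rewrite /wave addr0 cosBpihalf cosD; ring.
rewrite -[X in _ --> X](_ : cos c * 0 - sin c * 0 = 0); last by rewrite !mulr0 subr0.
by apply: cvgB; apply: cvgM => //; exact: cvg_cst.
Unshelve. all: by end_near. Qed.

End SquareMeasure.

(** * Equidistribution *)

Section Fejer.
Variable R : realType.
Local Notation tau := (pi *+ 2 : R).

Lemma cos_half_angle (x : R) : 1 - cos (tau * x) = 2 * sin (pi * x) ^+ 2.
Proof.
have -> : tau * x = (pi * x) *+ 2 by rewrite mulrnAl.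
by rewrite cos_mulr2n cos2sin2 -mulr_natl; lra.
Qed.

Lemma sin_pi_frac_neq0 (M : nat) (d : int) : (0 < `|d| < M)%N ->
  sin (pi * (d%:~R / M%:R)) != 0 :> R.
Proof.
move=> /andP[d0 dM].
have M0 : 0 < M%:R :> R by rewrite ltr0n (leq_trans _ dM).
have h : 0 < sin (pi * (`|d|%:R / M%:R)) :> R.
  have q0 : 0 < `|d|%:R / M%:R :> R by rewrite divr_gt0// ltr0n.
  have q1 : `|d|%:R / M%:R < 1 :> R by rewrite ltr_pdivrMr// mul1r ltr_nat.
  by apply: sin_gt0_pi; rewrite mulr_gt0 ?pi_gt0//= gtr_pMr ?pi_gt0.
have e : `|sin (pi * (d%:~R / M%:R))| = sin (pi * (`|d|%:R / M%:R)) :> R.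
  move: (h); case: (d) => n h'; first by rewrite gtr0_norm.
  by rewrite NegzE intrN mulNr mulrN sinN normrN gtr0_norm.
by rewrite -normr_eq0 e gt_eqF.
Qed.

(** A nontrivial character of [Z / M] is summed. Multiplied by [sin t] with [t = pi d / M], the sum
    telescopes, and its two ends differ by whole turns. *)
Lemma sum_cos_equidistributed (M : nat) (d : int) (x : R) :
  (0 < `|d| < M)%N ->
  \sum_(k < M) cos (x - tau * (d%:~R * (k%:R / M%:R))) = 0.
Proof.
move=> dM; have M0 : 0 < M%:R :> R by rewrite ltr0n; case/andP: dM => _; apply: leq_trans.
pose t : R := pi * (d%:~R / M%:R).
have st : sin t != 0 by exact: sin_pi_frac_neq0.
pose G (k : nat) : R := sin (x - tau * (d%:~R * (k%:R / M%:R)) + t).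
apply: (mulfI st); rewrite mulr0 mulr_sumr.
transitivity (\sum_(k < M) - 2^-1 * (G k.+1 - G k)).
  apply: eq_bigr => k _; set y := x - _.
  have -> : G k.+1 = sin (y - t).
    rewrite /G /y -natr1 /t; congr sin.
    by rewrite -mulr_natr; field; rewrite gt_eqF.
  rewrite /G -/y sinB sinD.
  by move: (sin t) (cos t) (sin y) (cos y) => ? ? ? ?; field.
rewrite -mulr_sumr -(big_mkord xpredT (fun k => G k.+1 - G k)) telescope_sumr//.
suff -> : G M = G 0%N by rewrite subrr mulr0.
rewrite /G divff ?gt_eqF// mulr1 mul0r mulr0 mulr0 subr0.
by rewrite addrAC -mulrN -intrN sinD2piz.
Qed.

(* [fej M u] is [|\sum_(a < M) exp (2 i pi a u)| ^ 2 / M ^ 2]; it is normalized so that its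
   translates by the [k / M] are a partition of unity. *)
Definition fejc (M : nat) (u : R) := \sum_(a < M) cos (tau * (a%:R * u)).
Definition fejs (M : nat) (u : R) := \sum_(a < M) sin (tau * (a%:R * u)).
Definition fej (M : nat) (u : R) := (M%:R ^+ 2)^-1 * (fejc M u ^+ 2 + fejs M u ^+ 2).

Lemma fej_ge0 M u : 0 <= fej M u.
Proof. by rewrite /fej mulr_ge0 ?invr_ge0 ?sqr_ge0// addr_ge0 ?sqr_ge0. Qed.

Lemma fejE M u : fej M u =
  (M%:R ^+ 2)^-1 * \sum_(a < M) \sum_(b < M) cos (tau * ((a%:Z - b%:Z)%:~R * u)).
Proof.
rewrite /fej; congr (_ * _); rewrite !expr2 /fejc /fejs !big_distrlr/= -big_split/=.
apply: eq_bigr => a _; rewrite -big_split/=; apply: eq_bigr => b _.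
by rewrite -cosB intrB; congr cos; ring.
Qed.

(** Off the diagonal [0 < |a - b| < M], and the sum over the [M] translates vanishes; each of the
    [M] diagonal terms contributes [M]. *)
Lemma sum_fej M x : (0 < M)%N -> \sum_(k < M) fej M (x - k%:R / M%:R) = 1.
Proof.
move=> M0; have M1 : M%:R != 0 :> R by rewrite pnatr_eq0 -lt0n.
under eq_bigr do rewrite fejE.
rewrite -mulr_sumr exchange_big/=.
have -> : \sum_(a < M) \sum_(k < M) \sum_(b < M)
    cos (tau * ((a%:Z - b%:Z)%:~R * (x - k%:R / M%:R))) = M%:R ^+ 2.
  rewrite (eq_bigr (fun=> M%:R)); last first.
    move=> a _; rewrite exchange_big/= (bigD1 a)//= [X in _ + X]big1 ?addr0.
      rewrite subrr; under eq_bigr do rewrite mul0r mulr0 cos0.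
      by rewrite sumr_const card_ord.
    move=> b ba; transitivity (\sum_(k < M) cos (tau * ((a%:Z - b%:Z)%:~R * x) -
        tau * ((a%:Z - b%:Z)%:~R * (k%:R / M%:R)))).
      by apply: eq_bigr => k _; congr cos; ring.
    apply: sum_cos_equidistributed.
    have := ltn_ord a; have := ltn_ord b.
    have : (b : nat) != a by [].
    by lia.
  by rewrite sumr_const card_ord -[LHS]mulr_natr expr2.
by rewrite mulVf// expf_neq0.
Qed.

(** Multiplication by [sin (pi u)] telescopes [fejc] and [fejs], so both products are at most 1 in
    absolute value; the factor [1 - cos] is twice the square of that sine. *)
Lemma fej_decay M u : fej M u * (1 - cos (tau * u)) <= 4 * (M%:R ^+ 2)^-1.
Proof.
rewrite cos_half_angle.
set s := sin (pi * u).
have hc : `|s * fejc M u| <= 1.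
  pose H (a : nat) : R := sin (tau * (a%:R * u) - pi * u).
  have -> : s * fejc M u = 2^-1 * (H M - H 0%N).
    rewrite -telescope_sumr// big_mkord !mulr_sumr; apply: eq_bigr => a _.
    have -> : H a.+1 = sin (tau * (a%:R * u) + pi * u).
      by rewrite /H -natr1 -mulr_natr; congr sin; ring.
    rewrite /H sinB sinD /s.
    by move: (sin _) (cos _) (sin _) (cos _) => ? ? ? ?; field.
  rewrite normrM gtr0_norm ?invr_gt0// ler_pdivrMl// mulr1.
  apply: le_trans (ler_normB _ _) _.
  by have -> : 2 = 1 + 1 :> R by []; rewrite lerD// sin_max.
have hs : `|s * fejs M u| <= 1.
  pose H (a : nat) : R := cos (tau * (a%:R * u) - pi * u).
  have -> : s * fejs M u = 2^-1 * (H 0%N - H M).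
    rewrite -(opprB (H M)) -telescope_sumr// big_mkord -sumrN !mulr_sumr.
    apply: eq_bigr => a _.
    have -> : H a.+1 = cos (tau * (a%:R * u) + pi * u).
      by rewrite /H -natr1 -mulr_natr; congr cos; ring.
    rewrite /H cosB cosD /s.
    by move: (sin _) (cos _) (sin _) (cos _) => ? ? ? ?; field.
  rewrite normrM gtr0_norm ?invr_gt0// ler_pdivrMl// mulr1.
  apply: le_trans (ler_normB _ _) _.
  by have -> : 2 = 1 + 1 :> R by []; rewrite lerD// cos_max.
have c2 : (s * fejc M u) ^+ 2 <= 1 by rewrite -real_normK ?num_real// expr_le1.
have s2 : (s * fejs M u) ^+ 2 <= 1 by rewrite -real_normK ?num_real// expr_le1.
have -> : fej M u * (2 * s ^+ 2) =
  2 * ((s * fejc M u) ^+ 2 + (s * fejs M u) ^+ 2) * (M%:R ^+ 2)^-1.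
  by rewrite /fej; ring.
by rewrite ler_wpM2r ?invr_ge0 ?sqr_ge0//; lra.
Qed.

End Fejer.

(** * Trigonometric approximation and equidistribution of generic points *)

Section Weyl.
Variable R : realType.
Local Notation tau := (pi *+ 2 : R).
Local Notation Q := (square_prob R).
Implicit Types (f psi : R * R -> R) (z p q : R * R).

Definition equidistributed z f := bmfun f /\ birkhoff f z n @[n --> \oo] --> \int[Q]_p f p.

Lemma birkhoffD f g z n : birkhoff (fun p => f p + g p) z n = birkhoff f z n + birkhoff g z n.
Proof. by rewrite /birkhoff big_split/= mulrDr. Qed.

Lemma birkhoffZ c f z n : birkhoff (fun p => c * f p) z n = c * birkhoff f z n.
Proof. by rewrite /birkhoff -mulr_sumr mulrCA. Qed.

Lemma equidistributed_cst z c : equidistributed z (fun=> c).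
Proof.
split; first exact: bmfun_cst.
rewrite Rint_cst; apply: cvg_near_cst; near=> n.
rewrite /birkhoff sumr_const card_ord -[X in _ * X]mulr_natl mulrA mulVf ?mul1r// pnatr_eq0.
by rewrite -lt0n; near: n; exists 1%N.
Unshelve. all: by end_near. Qed.

Lemma equidistributedD z f g : equidistributed z f -> equidistributed z g ->
  equidistributed z (fun p => f p + g p).
Proof.
move=> [bf cf] [bg cg]; split; first exact: bmfunD.
by rewrite RintD//; under eq_fun do rewrite birkhoffD; exact: cvgD.
Qed.

Lemma equidistributedZ z c f : equidistributed z f -> equidistributed z (fun p => c * f p).
Proof.
move=> [bf cf]; split; first by apply: bmfunM => //; exact: bmfun_cst.
rewrite RintZ//; under eq_fun do rewrite birkhoffZ; apply: cvgM => //.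
exact: cvg_cst.
Qed.

Lemma equidistributed_sum z I (r : seq I) (F : I -> R * R -> R) :
  (forall i, equidistributed z (F i)) ->
  equidistributed z (fun p => \sum_(i <- r) F i p).
Proof.
move=> eF; elim: r => [|i r ih].
  by under eq_fun do rewrite big_nil; exact: equidistributed_cst.
by under eq_fun do rewrite big_cons; exact: equidistributedD.
Qed.

Lemma equidistributed_wave z m n c : generic_pt z -> equidistributed z (wave m n c).
Proof.
move=> gz; have [[-> ->]|mn] := eqVneq (m, n) (0, 0).
  rewrite (_ : wave 0 0 c = fun=> cos c); first exact: equidistributed_cst.
  by apply/funext => p; rewrite /wave !mul0r addr0 mulr0 add0r.
split; first exact: bmfun_wave.
rewrite Rint_wave; first exact: (gz (m, n)).
by move: mn; rewrite xpair_eqE negb_and.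
Qed.

Lemma equidistributed_waveM z m n c m' n' c' : generic_pt z ->
  equidistributed z (fun p => wave m n c p * wave m' n' c' p).
Proof.
move=> gz; under eq_fun do rewrite waveM.
by apply: equidistributedZ; apply: equidistributedD; exact: equidistributed_wave.
Qed.

Lemma equidistributed_fej z M s t : generic_pt z ->
  equidistributed z (fun p => fej M (p.1 - s) * fej M (p.2 - t)).
Proof.
move=> gz.
have -> : (fun p : R * R => fej M (p.1 - s) * fej M (p.2 - t)) = (fun p =>
  ((M%:R ^+ 2)^-1 * (M%:R ^+ 2)^-1) * \sum_(a < M) \sum_(b < M) \sum_(a' < M) \sum_(b' < M)
    (wave (a%:Z - b%:Z) 0 (- (tau * ((a%:Z - b%:Z)%:~R * s))) p *
     wave 0 (a'%:Z - b'%:Z) (- (tau * ((a'%:Z - b'%:Z)%:~R * t))) p)).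
  apply/funext => p; rewrite !fejE mulrACA; congr (_ * _).
  rewrite mulr_suml; apply: eq_bigr => a _; rewrite mulr_suml; apply: eq_bigr => b _.
  rewrite mulr_sumr; apply: eq_bigr => a' _; rewrite mulr_sumr; apply: eq_bigr => b' _.
  by rewrite /wave mul0r addr0 mul0r add0r; congr (cos _ * cos _); ring.
apply: equidistributedZ.
apply: equidistributed_sum => a; apply: equidistributed_sum => b.
apply: equidistributed_sum => a'; apply: equidistributed_sum => b'.
exact: equidistributed_waveM.
Qed.

Lemma equidistributed_unif z psi : bmfun psi ->
  (forall e : R, 0 < e -> exists2 f, equidistributed z f & forall p, `|psi p - f p| <= e) ->
  equidistributed z psi.
Proof.
move=> bpsi approx; split=> //; apply/cvgrPdist_le => e e0.
have e3 : 0 < e / 3 by rewrite divr_gt0.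
have [f [bf cf] hf] := approx _ e3.
have h1 : `|\int[Q]_p psi p - \int[Q]_p f p| <= e / 3.
  have le1 (u v : R * R -> R) : bmfun u -> bmfun v -> (forall p, u p <= v p + e / 3) ->
      \int[Q]_p u p <= \int[Q]_p v p + e / 3.
    move=> bu bv uv; have bc := bmfun_cst (measurableTypeR R * measurableTypeR R)%type (e / 3).
    apply: (le_trans (Rint_le Q bu (bmfunD bv bc) uv)).
    by rewrite (RintD Q bv bc) Rint_cst.
  have h3 := le1 _ _ bf bpsi; have h4 := le1 _ _ bpsi bf.
  rewrite ler_distl; apply/andP; split.
    rewrite lerBlDr; apply: h3 => p.
    by have := hf p; rewrite ler_norml => /andP[]; lra.
  apply: h4 => p.
  by have := hf p; rewrite ler_norml => /andP[]; lra.
have h2 n : `|birkhoff psi z n - birkhoff f z n| <= e / 3.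
  rewrite /birkhoff -mulrBr -sumrB normrM ger0_norm ?invr_ge0//.
  have [->|n0] := posnP n; first by rewrite invr0 mul0r ltW.
  rewrite ler_pdivrMl ?ltr0n//; apply: le_trans (ler_norm_sum _ _ _) _.
  apply: (@le_trans _ _ (\sum_(j < n) (e / 3))); first by apply: ler_sum => j _; exact: hf.
  by rewrite sumr_const card_ord mulr_natl.
have /cvgrPdist_le/(_ _ e3) := cf; apply: filterS => n hn.
have := h2 n; rewrite distrC => h2n.
move: h1 h2n hn; rewrite !ler_norml => /andP[? ?] /andP[? ?] /andP[? ?].
by apply/andP; split; lra.
Qed.

Definition doubly_periodic psi := forall p (m n : int), psi (p.1 + m%:~R, p.2 + n%:~R) = psi p.

Definition unif_cont2 psi := forall e : R, 0 < e -> exists2 del : R, 0 < del &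
  forall p q, `|p.1 - q.1| < del -> `|p.2 - q.2| < del -> `|psi p - psi q| < e.

Lemma nearest_int (u : R) : exists m : int, `|u - m%:~R| <= 2^-1.
Proof.
exists (Num.floor (u + 2^-1)); rewrite ler_norml; apply/andP; split.
  by have := floor_le (u + 2^-1); lra.
by have := floorD1_gt (u + 2^-1); rewrite intrD; lra.
Qed.

(** The modulus of continuity is traded for a trigonometric test function. If a coordinate of
    [p - q] is at distance at least [d] from the integers, its [1 - cos] term is at least [s], and
    the factor [2 B / s] pays for any oscillation of [psi]. Otherwise periodicity brings the points
    together and uniform continuity applies. *)
Lemma korovkin psi (e : R) : doubly_periodic psi -> bmfun psi -> unif_cont2 psi -> 0 < e ->
  exists2 C : R, 0 <= C & forall p q, `|psi p - psi q| <=
    e + C * ((1 - cos (tau * (p.1 - q.1))) + (1 - cos (tau * (p.2 - q.2)))).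
Proof.
move=> per [_ [B hB]] uc e0; have [del del0 hdel] := uc _ e0.
(* Capped at 1/2 so that [tau * d <= pi], within the range where the cosine decreases. *)
pose d := Num.min del 2^-1.
have d0 : 0 < d by rewrite lt_min del0 invr_gt0/=.
have d2 : d <= 2^-1 by rewrite ge_min lexx orbT.
pose s := 1 - cos (tau * d).
have tau0 : 0 < tau by rewrite pmulrn_lgt0// pi_gt0.
have taupi : tau * 2^-1 = pi.
  by rewrite -mulr_natr; field.
have taule v : v <= 2^-1 -> tau * v <= pi.
  by move=> h; rewrite -[leRHS]taupi ler_wpM2l// ltW.
have s0 : 0 < s.
  rewrite subr_gt0 -[ltRHS]cos0 ltr_cos ?in_itv/= ?lexx ?pi_ge0//.
    by rewrite mulr_gt0.
  by rewrite mulr_ge0 ?(ltW tau0) ?(ltW d0)//= taule.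
have far u (m : int) : `|u - m%:~R| <= 2^-1 -> d <= `|u - m%:~R| -> s <= 1 - cos (tau * u).
  move=> h1 h2; rewrite lerD2l lerN2.
  have -> : cos (tau * u) = cos (tau * `|u - m%:~R|).
    rewrite -(ger0_norm (ltW tau0)) -normrM ger0_norm ?(ltW tau0)// cos_norm.
    by rewrite mulrBr -mulrN -intrN cosD2piz.
  rewrite le_eqVlt; have [->|ne] := eqVneq d (`|u - m%:~R|); first by rewrite eqxx.
  apply/orP; right; rewrite ltr_cos ?in_itv/=.
  - by rewrite ltr_pM2l// lt_neqAle ne.
  - by rewrite mulr_ge0 ?(ltW tau0) ?(ltW d0)//= taule.
  - by rewrite mulr_ge0 ?(ltW tau0)//= taule.
have B0 : 0 <= B by apply: le_trans (hB (0, 0)).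
have C0 : 0 <= 2 * B / s by rewrite divr_ge0 ?(ltW s0)// mulr_ge0.
exists (2 * B / s) => // p q.
have sge0 u : 0 <= 1 - cos (tau * u) by rewrite subr_ge0 cos_le1.
have diffB : `|psi p - psi q| <= 2 * B.
  by apply: le_trans (ler_normB _ _) _; have := hB p; have := hB q; lra.
have Cs u : s <= u -> 2 * B <= 2 * B / s * u.
  by move=> su; rewrite -mulrA ler_peMr ?mulr_ge0// mulrC ler_pdivlMr ?mul1r.
have [m hm] := nearest_int (p.1 - q.1).
have [n hn] := nearest_int (p.2 - q.2).
have [h1|h1] := leP d `|p.1 - q.1 - m%:~R|.
  apply: le_trans diffB _; apply: le_trans (Cs _ (far _ _ hm h1)) _.
  rewrite -[leLHS]add0r lerD ?(ltW e0)//.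
  by rewrite ler_wpM2l// lerDl.
have [h2|h2] := leP d `|p.2 - q.2 - n%:~R|.
  apply: le_trans diffB _; apply: le_trans (Cs _ (far _ _ hn h2)) _.
  rewrite -[leLHS]add0r lerD ?(ltW e0)//.
  by rewrite ler_wpM2l// lerDr.
rewrite -(per q m n) -[leLHS]addr0 lerD//; last by rewrite mulr_ge0// addr_ge0.
apply/ltW/hdel => /=; rewrite opprD addrA.
  by rewrite (lt_le_trans h1)// ge_min lexx.
by rewrite (lt_le_trans h2)// ge_min lexx.
Qed.

Lemma sum_weights (I : finType) (e C : R) (a b s t : I -> R) :
  \sum_k a k = 1 -> \sum_k b k = 1 ->
  \sum_k \sum_l (e * (a k * b l) + (C * (a k * s k) * b l + C * a k * (b l * t l))) =
  e + (C * \sum_k a k * s k + C * \sum_l b l * t l).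
Proof.
move=> a1 b1.
have -> : \sum_k \sum_l (e * (a k * b l) + (C * (a k * s k) * b l + C * a k * (b l * t l))) =
    \sum_k (e * a k + (C * (a k * s k) + C * a k * \sum_l b l * t l)).
  by apply: eq_bigr => k _; rewrite !big_split/= -!mulr_sumr b1 !mulr1.
by rewrite !big_split/= -mulr_suml -!mulr_sumr a1 !mulr1.
Qed.

(** The approximant samples [psi] on the grid of mesh [1 / M], weighted by products of Fejer
    kernels. As these form a partition of unity, the error is at most a weighted average of the
    bound in [korovkin]. *)
Lemma equidistributed_cont z psi : generic_pt z ->
  doubly_periodic psi -> bmfun psi -> unif_cont2 psi -> equidistributed z psi.
Proof.
move=> gz per bpsi uc; apply: equidistributed_unif => // e e0.
have e2 : 0 < e / 2 by rewrite divr_gt0.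
have [C C0 hC] := korovkin per bpsi uc e2.
(* By [fej_decay] the weighted sum of [1 - cos] is at most [4 / M] in each variable; this choice
   makes the total [8 C / M] at most [e / 2]. *)
pose M := (Num.truncn (16 * C / e)).+1.
have M0 : 0 < M%:R :> R by rewrite ltr0n.
have Me : 8 * C / M%:R <= e / 2.
  have : 16 * C / e < M%:R by rewrite truncnS_gt.
  by rewrite ltr_pdivrMr// => h; rewrite ler_pdivrMr//; lra.
pose w (k : 'I_M) (u : R) := fej M (u - k%:R / M%:R).
have w0 k u : 0 <= w k u by exact: fej_ge0.
have sw u : \sum_(k < M) w k u = 1 by exact: sum_fej.
have sw2 u : \sum_(k < M) w k u * (1 - cos (tau * (u - k%:R / M%:R))) <= 4 / M%:R.
  apply: (@le_trans _ _ (\sum_(k < M) 4 * (M%:R ^+ 2)^-1)).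
    by apply: ler_sum => k _; exact: fej_decay.
  rewrite sumr_const card_ord -[X in X <= _]mulr_natr expr2.
  by rewrite invfM mulrA mulfVK// gt_eqF.
exists (fun p => \sum_(k < M) \sum_(l < M)
    psi (k%:R / M%:R, l%:R / M%:R) * (w k p.1 * w l p.2)).
  apply: equidistributed_sum => k; apply: equidistributed_sum => l.
  by apply: equidistributedZ; exact: equidistributed_fej.
move=> p.
have -> : psi p = \sum_(k < M) \sum_(l < M) psi p * (w k p.1 * w l p.2).
  under eq_bigr do rewrite -mulr_sumr -mulr_sumr sw mulr1.
  by rewrite -mulr_sumr sw mulr1.
rewrite -sumrB; under eq_bigr do rewrite -sumrB.
apply: (@le_trans _ _ (\sum_(k < M) \sum_(l < M)
  (e / 2 * (w k p.1 * w l p.2) +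
   (C * (w k p.1 * (1 - cos (tau * (p.1 - k%:R / M%:R)))) * w l p.2 +
    C * w k p.1 * (w l p.2 * (1 - cos (tau * (p.2 - l%:R / M%:R)))))))).
  apply: le_trans (ler_norm_sum _ _ _) _; apply: ler_sum => k _.
  apply: le_trans (ler_norm_sum _ _ _) _; apply: ler_sum => l _.
  rewrite -mulrBl normrM (ger0_norm (mulr_ge0 (w0 k p.1) (w0 l p.2))).
  have /(ler_wpM2r (mulr_ge0 (w0 k p.1) (w0 l p.2))) := hC p (k%:R / M%:R, l%:R / M%:R).
  move=> h; apply: le_trans h _; rewrite le_eqVlt; apply/orP; left; apply/eqP => /=.
  ring.
have -> : (\sum_(k < M) \sum_(l < M)
  (e / 2 * (w k p.1 * w l p.2) +
   (C * (w k p.1 * (1 - cos (tau * (p.1 - k%:R / M%:R)))) * w l p.2 +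
    C * w k p.1 * (w l p.2 * (1 - cos (tau * (p.2 - l%:R / M%:R))))))) =
  e / 2 + (C * (\sum_(k < M) w k p.1 * (1 - cos (tau * (p.1 - k%:R / M%:R)))) +
           C * (\sum_(l < M) w l p.2 * (1 - cos (tau * (p.2 - l%:R / M%:R))))).
  exact: (@sum_weights _ (e / 2) C (w^~ p.1) (w^~ p.2) _ _ (sw p.1) (sw p.2)).
have h1 := ler_wpM2l C0 (sw2 p.1).
have h2 := ler_wpM2l C0 (sw2 p.2).
have : C * (4 / M%:R) + C * (4 / M%:R) = 8 * C / M%:R by ring.
lra.
Qed.

End Weyl.

(** * The diffeomorphism *)

Section Coordinates.
Variable R : realType.

Definition o0 : 'I_4 := ord0.
Definition o1 : 'I_4 := Ordinal (isT : (1 < 4)%N).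
Definition o2 : 'I_4 := Ordinal (isT : (2 < 4)%N).
Definition o3 : 'I_4 := Ordinal (isT : (3 < 4)%N).

Lemma ord4_ind (P : 'I_4 -> Prop) : P o0 -> P o1 -> P o2 -> P o3 -> forall i, P i.
Proof.
move=> p0 p1 p2 p3 [[|[|[|[|//]]]] h].
- by rewrite (_ : Ordinal h = o0)//; exact: val_inj.
- by rewrite (_ : Ordinal h = o1)//; exact: val_inj.
- by rewrite (_ : Ordinal h = o2)//; exact: val_inj.
- by rewrite (_ : Ordinal h = o3)//; exact: val_inj.
Qed.

Lemma sum_ord4 (V : nmodType) (F : 'I_4 -> V) : \sum_i F i = F o0 + F o1 + F o2 + F o3.
Proof.
rewrite !big_ord_recl big_ord0 addr0 !addrA.
by congr (_ + F _ + F _ + F _); exact: val_inj.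
Qed.

Definition vec (a b c d : R) : 'rV[R]_4 := row4 (a, b, c, d).

Lemma vec_eta (v : 'rV[R]_4) : v = vec (v 0 o0) (v 0 o1) (v 0 o2) (v 0 o3).
Proof. by apply/rowP; apply: ord4_ind; rewrite mxE. Qed.

Lemma vecE a b c d : ((vec a b c d) 0 o0 = a) * ((vec a b c d) 0 o1 = b) *
  ((vec a b c d) 0 o2 = c) * ((vec a b c d) 0 o3 = d).
Proof. by rewrite !mxE. Qed.

Lemma vecD a b c d a' b' c' d' :
  vec a b c d + vec a' b' c' d' = vec (a + a') (b + b') (c + c') (d + d').
Proof. by apply/rowP; apply: ord4_ind; rewrite !mxE. Qed.

Lemma vecN a b c d : - vec a b c d = vec (- a) (- b) (- c) (- d).
Proof. by apply/rowP; apply: ord4_ind; rewrite !mxE. Qed.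

Lemma vecZ k a b c d : k *: vec a b c d = vec (k * a) (k * b) (k * c) (k * d).
Proof. by apply/rowP; apply: ord4_ind; rewrite !mxE. Qed.

Lemma enorm_vec a b c d : enorm (vec a b c d) = Num.sqrt (a ^+ 2 + b ^+ 2 + c ^+ 2 + d ^+ 2).
Proof. by rewrite /enorm sum_ord4 !vecE. Qed.

(** The entries follow the right action on rows: the first new coordinate is [a x + c y], and the
    circle directions are diagonal. *)
Definition jac4 (a b c e p q : R) : 'M[R]_4 :=
  \matrix_(i < 4, j < 4) nth 0 (nth [::] [:: [:: a; b; 0; 0]; [:: c; e; 0; 0];
    [:: 0; 0; p; 0]; [:: 0; 0; 0; q]] i) j.

Lemma mul_vec_jac4 x y s t a b c e p q : vec x y s t *m jac4 a b c e p q =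
  vec (a * x + c * y) (b * x + e * y) (p * s) (q * t).
Proof.
by apply/rowP; apply: ord4_ind; rewrite !mxE sum_ord4 !mxE/=; ring.
Qed.

Lemma mulmx_vec_inj (A B : 'M[R]_4) :
  (forall a b c d, vec a b c d *m A = vec a b c d *m B) -> A = B.
Proof.
move=> h; apply/row_matrixP => i; rewrite !rowE.
by rewrite (vec_eta (delta_mx 0 i)).
Qed.

Lemma jac4_mul a b c e p q a' b' c' e' p' q' :
  jac4 a b c e p q *m jac4 a' b' c' e' p' q' =
  jac4 (a' * a + c' * b) (b' * a + e' * b) (a' * c + c' * e) (b' * c + e' * e) (p * p') (q * q').
Proof.
apply: mulmx_vec_inj => x y s t; rewrite mulmxA !mul_vec_jac4.
by congr vec; ring.
Qed.

Lemma jac4_1 : jac4 1 0 0 1 1 1 = 1%:M.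
Proof. by apply: mulmx_vec_inj => x y s t; rewrite mulmx1 mul_vec_jac4; congr vec; ring. Qed.

End Coordinates.

Section Lift.
Variable R : realType.
Variables (a b c e : int) (f df h dh : R -> R).
Hypothesis f_derive : forall s : R, is_derive s (1 : R) f (df s).
Hypothesis h_derive : forall s : R, is_derive s (1 : R) h (dh s).
Hypothesis df_cont : continuous df.
Hypothesis dh_cont : continuous dh.
Hypothesis f_deg1 : forall s (m : int), f (s + m%:~R) = f s + m%:~R.
Hypothesis h_deg1 : forall s (m : int), h (s + m%:~R) = h s + m%:~R.

(** A common form for the diffeomorphism and its inverse; integer coefficients and the degree-one
    hypotheses on [f] and [h] let it descend to the torus. *)
Definition lift4 (v : 'rV[R]_4) : 'rV[R]_4 :=
  vec (a%:~R * v 0 o0 + c%:~R * v 0 o1) (b%:~R * v 0 o0 + e%:~R * v 0 o1)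
    (f (v 0 o2)) (h (v 0 o3)).

Lemma lift4_vec x y s t : lift4 (vec x y s t) =
  vec (a%:~R * x + c%:~R * y) (b%:~R * x + e%:~R * y) (f s) (h t).
Proof. by rewrite /lift4 !vecE. Qed.

Lemma lift4_equivariant : equivariant lift4.
Proof.
move=> x k hk.
have /intrP[k0 e0] := hk o0; have /intrP[k1 e1] := hk o1.
have /intrP[k2 e2] := hk o2; have /intrP[k3 e3] := hk o3.
rewrite (vec_eta x) (vec_eta k) vecD !lift4_vec vecN vecD e0 e1 e2 e3 f_deg1 h_deg1.
apply: ord4_ind; rewrite vecE.
- rewrite (_ : _ - _ = a%:~R * k0%:~R + c%:~R * k1%:~R); last by ring.
  by rewrite rpredD// rpredM// intr_int.
- rewrite (_ : _ - _ = b%:~R * k0%:~R + e%:~R * k1%:~R); last by ring.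
  by rewrite rpredD// rpredM// intr_int.
- by rewrite addrAC subrr add0r intr_int.
- by rewrite addrAC subrr add0r intr_int.
Qed.

Let coord_differentiable (k : R -> R) (i : 'I_4) (x : 'rV[R]_4) :
  derivable k (x 0 i) 1 -> differentiable (fun v : 'rV[R]_4 => k (v 0 i)) x.
Proof.
move=> dk; apply: (@differentiable_comp _ _ _ _ (fun v : 'rV[R]_4 => v 0 i) k).
  exact: differentiable_coord.
exact/derivable1_diffP.
Qed.

Lemma lift4_differentiable x : differentiable lift4 x.
Proof.
have -> : lift4 = (fun v => (a%:~R * v 0 o0 + c%:~R * v 0 o1) *: delta_mx 0 o0) \+
    (fun v => (b%:~R * v 0 o0 + e%:~R * v 0 o1) *: delta_mx 0 o1) \+
    (fun v => f (v 0 o2) *: delta_mx 0 o2) \+ (fun v => h (v 0 o3) *: delta_mx 0 o3).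
  apply/funext => v /=.
  by apply/rowP; apply: ord4_ind; rewrite !mxE/=; ring.
have lin (k l : R) : differentiable (fun v : 'rV[R]_4 => k * v 0 o0 + l * v 0 o1) x.
  by apply: differentiableD; apply: differentiableZ; exact: differentiable_coord.
apply: differentiableD; first apply: differentiableD; first apply: differentiableD.
- exact: differentiableZl.
- exact: differentiableZl.
- apply: differentiableZl; apply: coord_differentiable.
  by have [] := f_derive (x 0 o2).
- apply: differentiableZl; apply: coord_differentiable.
  by have [] := h_derive (x 0 o3).
Qed.

Let derive_coord (k dk : R -> R) (i : 'I_4) (x v : 'rV[R]_4) :
  (forall s : R, is_derive s (1 : R) k (dk s)) ->
  'D_v (fun v : 'rV[R]_4 => k (v 0 i)) x = v 0 i * dk (x 0 i).
Proof.
move=> hk; pose co (v : 'rV[R]_4) : R := v 0 i.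
have [dk1 dk2] := hk (x 0 i).
have dc : differentiable co x by exact: differentiable_coord.
have dkx : differentiable k (co x) by exact/derivable1_diffP.
have dcE : 'd co x v = v 0 i.
  have h1 : derivable (@idfun 'rV[R]_4) x v by exact: derivable_id.
  have := congr1 (fun M : 'rV[R]_4 => M 0 i) (derive_mx h1).
  by rewrite derive_id mxE => ->; apply/esym/deriveE.
have dkc : differentiable (k \o co) x by exact: differentiable_comp.
apply: (etrans (deriveE v dkc)).
apply: (etrans (congr1 (fun F => F v) (diff_comp dc dkx))) => /=.
rewrite dcE -[v 0 i in LHS]mulr1 -[_ * 1]/(v 0 i *: (1 : R)) linearZ/=.
by congr (_ * _); rewrite -dk2; apply/esym/deriveE.
Qed.

Lemma lift4_jacobian x :
  jacobian lift4 x = jac4 a%:~R b%:~R c%:~R e%:~R (df (x 0 o2)) (dh (x 0 o3)).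
Proof.
apply: mulmx_vec_inj => y0 y1 y2 y3.
have dL := lift4_differentiable x.
rewrite -(deriveEjacobian (vec y0 y1 y2 y3) dL) mul_vec_jac4.
rewrite derive_mx; last exact: diff_derivable.
have lin (k l : R) : 'D_(vec y0 y1 y2 y3) (fun v : 'rV[R]_4 => k * v 0 o0 + l * v 0 o1) x =
    k * y0 + l * y1.
  have dmul (t s : R) : is_derive s (1 : R) (fun u => t * u) t.
    by apply: is_derive_eq; rewrite /GRing.scale/= mulr1.
  have dco (t : R) i : derivable (fun v : 'rV[R]_4 => t * v 0 i) x (vec y0 y1 y2 y3).
    by apply: diff_derivable; apply: differentiableZ; exact: differentiable_coord.
  apply: (etrans (deriveD (dco k o0) (dco l o1))).
  rewrite (derive_coord o0 x _ (dmul k)) (derive_coord o1 x _ (dmul l)) !vecE.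
  by rewrite mulrC [y1 * _]mulrC.
apply/rowP; apply: ord4_ind; rewrite mxE vecE.
- by under eq_fun do rewrite /lift4 vecE; exact: lin.
- by under eq_fun do rewrite /lift4 vecE; exact: lin.
- under eq_fun do rewrite /lift4 vecE.
  by rewrite (derive_coord o2 x _ f_derive) vecE mulrC.
- under eq_fun do rewrite /lift4 vecE.
  by rewrite (derive_coord o3 x _ h_derive) vecE mulrC.
Qed.

Lemma lift4_jacobian_continuous : continuous (jacobian lift4).
Proof.
have -> : jacobian lift4 = fun x : 'rV[R]_4 => jac4 a%:~R b%:~R c%:~R e%:~R 0 0 +
    (df (x 0 o2) *: delta_mx o2 o2 + dh (x 0 o3) *: delta_mx o3 o3).
  apply/funext => x; rewrite lift4_jacobian.
  by apply/matrixP; apply: ord4_ind; apply: ord4_ind; rewrite !mxE/=; ring.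
have cc (k : R -> R) i : continuous k -> continuous (fun x : 'rV[R]_4 => k (x 0 i)).
  move=> ck x; apply: (@continuous_comp _ _ _ (fun x : 'rV[R]_4 => x 0 i) k); last exact: ck.
  exact: coord_continuous.
have cz (k : R -> R) i (M : 'M[R]_4) : continuous k ->
    continuous (fun x : 'rV[R]_4 => k (x 0 i) *: M).
  move=> ck y; apply: (@continuous_comp _ _ _ (fun x : 'rV[R]_4 => k (x 0 i)) ( *:%R ^~ M)).
    exact: cc.
  exact: scalel_continuous.
move=> x; have Fx := nbhs_filter x.
by apply: cvgD; [exact: cvg_cst|apply: cvgD; exact: cz].
Qed.

End Lift.

(** * Differentials of iterates and the chain rule on lifts *)

Section IterLift.
Variables (R : realType) (d : nat).
Local Notation T := (torus R d).
Variable G : 'rV[R]_d -> 'rV[R]_d.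
Hypothesis eG : equivariant G.
Hypothesis dG : forall x, differentiable G x.

Lemma iter_equivariant n : equivariant (iter n G).
Proof.
elim: n => [x k hk|n ih x k hk] /=; first by rewrite addrAC subrr add0r.
have -> : iter n G (x + k) = iter n G x + (iter n G (x + k) - iter n G x).
  by rewrite [RHS]addrC subrK.
by apply: eG; exact: ih.
Qed.

Lemma iter_differentiable n x : differentiable (iter n G) x.
Proof.
elim: n => [|n ih]; first by [].
exact: (differentiable_comp ih (dG _)).
Qed.

Lemma iter_torus_map n : iter n (torus_map G) = torus_map (iter n G).
Proof.
apply/funext => p; rewrite -(torus_proj_repr p) iter_torus_map_proj//.
by rewrite torus_map_proj//; exact: iter_equivariant.
Qed.

Lemma tdiff_iter n p : tdiff (iter n (torus_map G)) p = jacobian (iter n G) (repr p).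
Proof.
rewrite iter_torus_map -{1}(torus_proj_repr p) tdiff_lift//.
  exact: iter_equivariant.
by move=> x; exact: iter_differentiable.
Qed.

Lemma mul_jacobian (H : 'rV[R]_d -> 'rV[R]_d) (v x : 'rV[R]_d) : v *m jacobian H x = 'd H x v.
Proof. by rewrite /jacobian mul_rV_lin1. Qed.

Lemma mul_jacobian_iterS n (v x : 'rV[R]_d) :
  v *m jacobian (iter n.+1 G) x = v *m jacobian (iter n G) x *m jacobian G (iter n G x).
Proof.
apply: (etrans (mul_jacobian _ _ _)); apply: (etrans _ (esym (mul_jacobian _ _ _))).
apply: (etrans (congr1 (fun F => F v) (diff_comp (iter_differentiable n x) (dG (iter n G x))))).
by move=> /=; congr ('d G _ _); apply/esym/mul_jacobian.
Qed.

Lemma mul_jacobian_iter0 (v x : 'rV[R]_d) : v *m jacobian (iter 0 G) x = v.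
Proof.
apply: (etrans (mul_jacobian _ _ _)).
have h1 : differentiable (@idfun 'rV[R]_d) x by [].
apply: (etrans (esym (deriveE v h1))); exact: derive_id.
Qed.

End IterLift.

(** * The product map, its dominated splitting and its zero exponent *)

Section Maps.
Variables (R : realType) (l : nat).
Hypothesis l0 : (0 < l)%N.
Implicit Types (s t : R) (m : int).

Let lR : l%:R != 0 :> R. Proof. by rewrite pnatr_eq0 -lt0n. Qed.

(** Conjugate of [bumpf] by multiplication by [l]: the slopes take the same values and the fixed
    points become the multiples of [1 / l]. *)
Definition cmap s : R := bumpf (l%:R * s) / l%:R.
Definition dcmap s : R := dbumpf (l%:R * s).
Definition cinv s : R := bumpg (l%:R * s) / l%:R.
Definition dcinv s : R := (dbumpf (bumpg (l%:R * s)))^-1.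

Let scale_derive (k dk : R -> R) s : (forall u : R, is_derive u (1 : R) k (dk u)) ->
  is_derive s (1 : R) (fun s => k (l%:R * s) / l%:R) (dk (l%:R * s)).
Proof.
move=> hk.
have hm : is_derive s (1 : R) (fun s => l%:R * s) (l%:R : R).
  by apply: is_derive_eq; rewrite /GRing.scale/= mulr1.
have hc := is_derive1_comp (hk (l%:R * s)) hm.
have -> : (fun s => k (l%:R * s) / l%:R) = (l%:R^-1 : R) \*: (k \o (fun s => l%:R * s)).
  by apply/funext => u /=; rewrite /GRing.scale/= mulrC.
apply: is_derive_eq; rewrite /GRing.scale/=.
by field; rewrite lR.
Qed.

Lemma cmap_derive s : is_derive s (1 : R) cmap (dcmap s).
Proof. by apply: scale_derive; exact: bumpf_derive. Qed.

Lemma cinv_derive s : is_derive s (1 : R) cinv (dcinv s).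
Proof. by apply: (@scale_derive _ (fun y => (dbumpf (bumpg y))^-1)); exact: bumpg_derive. Qed.

Let mul_cont : continuous (fun s : R => l%:R * s).
Proof. by move=> s; apply: cvgM; [exact: cvg_cst|exact: cvg_id]. Qed.

Lemma dcmap_continuous : continuous dcmap.
Proof.
move=> s; apply: (@continuous_comp _ _ _ (fun s : R => l%:R * s) (@dbumpf R)).
  exact: mul_cont.
exact: dbumpf_continuous.
Qed.

Lemma dbumpgV_continuous : continuous (fun y : R => (dbumpf (bumpg y))^-1).
Proof.
move=> y; apply: cvgV; first by rewrite gt_eqF// dbumpf_gt0.
apply: (@continuous_comp _ _ _ (@bumpg R) (@dbumpf R)); first exact: bumpg_continuous.
exact: dbumpf_continuous.
Qed.

Lemma dcinv_continuous : continuous dcinv.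
Proof.
move=> s; apply: (@continuous_comp _ _ _ (fun s : R => l%:R * s) (fun y => (dbumpf (bumpg y))^-1)).
  exact: mul_cont.
exact: dbumpgV_continuous.
Qed.

Lemma cmapDz s m : cmap (s + m%:~R) = cmap s + m%:~R.
Proof.
rewrite /cmap mulrDr.
have -> : l%:R * m%:~R = (l%:Z * m)%:~R :> R by rewrite intrM.
by rewrite bumpfDz mulrDl intrM -pmulrn mulrAC divff// mul1r.
Qed.

Lemma cinvDz s m : cinv (s + m%:~R) = cinv s + m%:~R.
Proof.
rewrite /cinv mulrDr.
have -> : l%:R * m%:~R = (l%:Z * m)%:~R :> R by rewrite intrM.
by rewrite bumpgDz mulrDl intrM -pmulrn mulrAC divff// mul1r.
Qed.

Lemma cmapK : cancel cmap cinv.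
Proof.
by move=> s; rewrite /cinv /cmap [X in bumpg X]mulrC divfK// bumpfK mulrAC divff// mul1r.
Qed.

Lemma cinvK : cancel cinv cmap.
Proof.
by move=> s; rewrite /cinv /cmap [X in bumpf X]mulrC divfK// bumpgK mulrAC divff// mul1r.
Qed.

Lemma iter_cmap n s : iter n cmap s = iter n (@bumpf R) (l%:R * s) / l%:R.
Proof.
elim: n => [|n ih]; first by rewrite /= mulrAC divff// mul1r.
by rewrite !iterS ih /cmap [X in bumpf X]mulrC divfK.
Qed.

Definition liftg : 'rV[R]_4 -> 'rV[R]_4 := lift4 2 1 1 1 cmap (@bumpf R).
Definition liftV : 'rV[R]_4 -> 'rV[R]_4 := lift4 1 (-1) (-1) 2 cinv (@bumpg R).

Lemma liftg_vec x y s t : liftg (vec x y s t) = vec (2 * x + y) (x + y) (cmap s) (bumpf t).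
Proof. by rewrite /liftg lift4_vec !mul1r. Qed.

Lemma liftV_vec x y s t : liftV (vec x y s t) = vec (x - y) (2 * y - x) (cinv s) (bumpg t).
Proof.
rewrite /liftV lift4_vec; congr vec; rewrite ?intrN; last by rewrite mulN1r mulrC addrC; ring.
by rewrite mul1r mulN1r.
Qed.

Lemma liftgK : cancel liftg liftV.
Proof.
by move=> v; rewrite (vec_eta v) liftg_vec liftV_vec cmapK bumpfK; congr vec; ring.
Qed.

Lemma liftVK : cancel liftV liftg.
Proof.
by move=> v; rewrite (vec_eta v) liftV_vec liftg_vec cinvK bumpgK; congr vec; ring.
Qed.

Lemma liftg_equivariant : equivariant liftg.
Proof. by apply: lift4_equivariant; [exact: cmapDz|exact: bumpfDz]. Qed.

Lemma liftV_equivariant : equivariant liftV.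
Proof. by apply: lift4_equivariant; [exact: cinvDz|exact: bumpgDz]. Qed.

Lemma liftg_differentiable x : differentiable liftg x.
Proof. exact: (lift4_differentiable 2 1 1 1 cmap_derive (@bumpf_derive R)). Qed.

Lemma liftV_differentiable x : differentiable liftV x.
Proof. exact: (lift4_differentiable 1 (-1) (-1) 2 cinv_derive (@bumpg_derive R)). Qed.

Lemma liftg_jacobian x :
  jacobian liftg x = jac4 2 1 1 1 (dcmap (x 0 o2)) (dbumpf (x 0 o3)).
Proof. exact: (lift4_jacobian 2 1 1 1 cmap_derive (@bumpf_derive R)). Qed.

Lemma liftV_jacobian x :
  jacobian liftV x = jac4 1 (-1) (-1) 2 (dcinv (x 0 o2)) (dbumpf (bumpg (x 0 o3)))^-1.
Proof. exact: (lift4_jacobian 1 (-1) (-1) 2 cinv_derive (@bumpg_derive R)). Qed.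

Definition torusg := torus_map liftg.
Definition torusV := torus_map liftV.

Lemma torusg_C1_diffeo : C1_diffeo torusg torusV.
Proof.
split.
- move=> p; rewrite -(torus_proj_repr p) /torusg torus_map_proj; last exact: liftg_equivariant.
  by rewrite /torusV torus_map_proj ?liftgK//; exact: liftV_equivariant.
- move=> p; rewrite -(torus_proj_repr p) /torusV torus_map_proj; last exact: liftV_equivariant.
  by rewrite /torusg torus_map_proj ?liftVK//; exact: liftg_equivariant.
- apply: C1_lift; [exact: liftg_equivariant|exact: liftg_differentiable|].
  exact: (lift4_jacobian_continuous cmap_derive (@bumpf_derive R)
     dcmap_continuous (@dbumpf_continuous R)).
- apply: C1_lift; [exact: liftV_equivariant|exact: liftV_differentiable|].
  exact: (lift4_jacobian_continuous cinv_derive (@bumpg_derive R)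
     dcinv_continuous dbumpgV_continuous).
Qed.

Local Notation gr := (golden R).

Lemma tdiff_torusg_unstable n p a :
  vec (gr * a) a 0 0 *m tdiff (iter n torusg) p = (gr + 1) ^+ n *: vec (gr * a) a 0 0.
Proof.
rewrite (tdiff_iter liftg_equivariant liftg_differentiable).
elim: n => [|n ih]; first by rewrite mul_jacobian_iter0 scale1r.
rewrite (mul_jacobian_iterS liftg_differentiable) ih -scalemxAl liftg_jacobian mul_vec_jac4.
rewrite exprSr -scalerA; congr (_ *: _); rewrite vecZ.
have := goldenE R; rewrite expr2 => g2.
congr vec; rewrite ?mulr0//; last by ring.
have -> : (gr + 1) * (gr * a) = (gr * gr) * a + gr * a by ring.
by rewrite g2; ring.
Qed.

(** The inverse matrix has the same eigenvector, with eigenvalue [2 - gr = 1 / (gr + 1)]. *)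
Lemma tdiff_torusV_unstable n p a :
  vec (gr * a) a 0 0 *m tdiff (iter n torusV) p = (2 - gr) ^+ n *: vec (gr * a) a 0 0.
Proof.
rewrite (tdiff_iter liftV_equivariant liftV_differentiable).
elim: n => [|n ih]; first by rewrite mul_jacobian_iter0 scale1r.
rewrite (mul_jacobian_iterS liftV_differentiable) ih -scalemxAl liftV_jacobian mul_vec_jac4.
rewrite exprSr -scalerA; congr (_ *: _); rewrite vecZ.
have := goldenE R; rewrite expr2 => g2.
congr vec; rewrite ?mulr0//; last by ring.
have -> : (2 - gr) * (gr * a) = 2 * gr * a - (gr * gr) * a by ring.
by rewrite g2; ring.
Qed.

(** The stable line of the cat map and the two circle directions do not mix; each circle component
    picks up the product of the slopes along the orbit. *)
Lemma tdiff_torusg_center n p a u w :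
  vec a (- (gr * a)) u w *m tdiff (iter n torusg) p =
  vec ((2 - gr) ^+ n * a) (- (gr * ((2 - gr) ^+ n * a)))
    (u * \prod_(j < n) dcmap (iter j liftg (repr p) 0 o2))
    (w * \prod_(j < n) dbumpf (iter j liftg (repr p) 0 o3)).
Proof.
rewrite (tdiff_iter liftg_equivariant liftg_differentiable).
elim: n => [|n ih]; first by rewrite mul_jacobian_iter0 !big_ord0 !expr0 !mulr1 !mul1r.
rewrite (mul_jacobian_iterS liftg_differentiable) ih liftg_jacobian mul_vec_jac4.
have := goldenE R; rewrite expr2 => g2.
rewrite !big_ord_recr/= exprS; congr vec; [ring| |ring|ring].
set b := (2 - gr) ^+ n * a.
have -> : gr * ((2 - gr) * (2 - gr) ^+ n * a) = 2 * gr * b - (gr * gr) * b by rewrite /b; ring.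
rewrite -/b g2; ring.
Qed.

Definition Eu : 'M[R]_4 := (<<vec gr 1 0 0>>)%MS.
(** The orthogonal complement of the unstable direction. As the cat map is symmetric, this is its
    stable line plus the two circle directions. *)
Definition Ecs : 'M[R]_4 := kermx (vec gr 1 0 0)^T.

Lemma sub_EuP v : reflect (exists a, v = vec (gr * a) a 0 0) (v <= Eu)%MS.
Proof.
rewrite /Eu genmxE; apply: (iffP sub_rVP) => -[a ->]; exists a.
  by rewrite vecZ !mulr0 mulr1 mulrC.
by rewrite vecZ !mulr0 mulr1 mulrC.
Qed.

Lemma vec_dot a b c e a' b' c' e' : vec a b c e *m (vec a' b' c' e' : 'rV[R]_4)^T =
  (a * a' + b * b' + c * c' + e * e')%:M.
Proof.
apply/matrixP => i j; rewrite !ord1 !mxE sum_ord4 !mxE/=.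
by rewrite mulr1n.
Qed.

Lemma sub_EcsP v : reflect (exists a u w, v = vec a (- (gr * a)) u w) (v <= Ecs)%MS.
Proof.
apply: (iffP sub_kermxP) => [|[a [u [w ->]]]]; last first.
  by rewrite vec_dot (_ : _ + _ = 0) ?scalemx1 ?raddf0//; ring.
rewrite {1}(vec_eta v) vec_dot => /matrixP/(_ 0 0); rewrite !mxE mulr1n => h.
exists (v 0 o0), (v 0 o2), (v 0 o3); rewrite {1}(vec_eta v); congr vec.
move: h; move: (v 0 o0) (v 0 o1) (v 0 o2) (v 0 o3) => x y z t.
by rewrite !mulr0 !addr0 mulr1 => h; lra.
Qed.

Lemma subbundle_cst (E : 'M[R]_4) : subbundle (\rank E) (fun _ : torus R 4 => E).
Proof.
move=> p; exists (fun=> row_base E); near=> q; split.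
- exact: (@cst_continuous (torus R 4) 'M[R]_(\rank E, 4) (row_base E) q).
- exact: row_base_free.
- by apply/eqmxP; exact: eq_row_base.
Unshelve. all: by end_near. Qed.

Lemma tdiff_torusg p :
  tdiff torusg p = jac4 2 1 1 1 (dcmap (repr p 0 o2)) (dbumpf (repr p 0 o3)).
Proof.
rewrite -{1}(torus_proj_repr p) tdiff_lift ?liftg_jacobian//.
  exact: liftg_equivariant.
exact: liftg_differentiable.
Qed.

Lemma dcmap_bounds s : (1 / 2 <= dcmap s <= 3 / 2) && (0 < dcmap s).
Proof. by rewrite /dcmap dbumpf_ge dbumpf_le dbumpf_gt0. Qed.

(** The reverse inclusion comes from the inverse matrix, whose circle slopes are [P^-1] and [Q^-1];
    this is why [A] and [B] range over all reals. *)
Lemma jac4_stable (E : 'M[R]_4) (P Q : R) : P != 0 -> Q != 0 ->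
  (forall (v : 'rV[R]_4) A B, (v <= E)%MS -> (v *m jac4 2 1 1 1 A B <= E)%MS) ->
  (forall (v : 'rV[R]_4) A B, (v <= E)%MS -> (v *m jac4 1 (-1) (-1) 2 A B <= E)%MS) ->
  (E *m jac4 2 1 1 1 P Q == E)%MS.
Proof.
move=> P0 Q0 h1 h2.
have st (D : 'M[R]_4) : (forall v : 'rV_4, (v <= E)%MS -> (v *m D <= E)%MS) -> (E *m D <= E)%MS.
  move=> h; apply/rV_subP => v /submxP[w ->].
  by rewrite mulmxA h// submxMl.
apply/andP; split; first by apply: st => v; exact: h1.
have e : jac4 1 (-1) (-1) 2 P^-1 Q^-1 *m jac4 2 1 1 1 P Q = 1%:M.
  rewrite jac4_mul -jac4_1; congr jac4; by [ring|rewrite mulVf].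
rewrite -[X in (X <= _)%MS]mulmx1 -e mulmxA.
by apply: submxMr; apply: st => v; exact: h2.
Qed.

Lemma enorm_vec_le (k a b c e a' b' c' e' : R) : 0 <= k ->
  `|a'| <= k * `|a| -> `|b'| <= k * `|b| -> `|c'| <= k * `|c| -> `|e'| <= k * `|e| ->
  enorm (vec a' b' c' e') <= k * enorm (vec a b c e).
Proof.
move=> k0 ha hb hc he; rewrite !enorm_vec.
rewrite -[X in X * _]ger0_norm// -sqrtr_sqr -sqrtrM ?sqr_ge0//.
apply: ler_wsqrtr; rewrite !mulrDr.
have sq (x y : R) : `|x| <= k * `|y| -> x ^+ 2 <= k ^+ 2 * y ^+ 2.
  move=> h; rewrite -(real_normK (num_real x)) -(real_normK (num_real y)) -exprMn.
  by rewrite lerXn2r// nnegrE mulr_ge0.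
by apply: lerD; [apply: lerD; [apply: lerD|]|]; exact: sq.
Qed.

Lemma enorm_vecZ (k a b c e : R) : enorm (k *: vec a b c e) = `|k| * enorm (vec a b c e).
Proof.
rewrite vecZ !enorm_vec -sqrtr_sqr -sqrtrM ?sqr_ge0//.
by congr Num.sqrt; ring.
Qed.

Lemma torusg_partially_hyperbolic : partially_hyperbolic torusg torusV.
Proof.
have g2 := goldenE R; have g3 := golden_gt1 R; have g4 := golden_lt2 R.
exists (fun=> Eu), (fun=> Ecs); split.
- split.
    exists (\rank Eu); last exact: subbundle_cst.
    rewrite lt0n mxrank_eq0; apply/eqP => E0.
    have : (vec gr 1 0 0 <= Eu)%MS by apply/sub_EuP; exists 1; rewrite mulr1.
    rewrite E0 submx0 => /eqP/(congr1 (fun v : 'rV_4 => v 0 o1)); rewrite vecE mxE.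
    by move/eqP; rewrite oner_eq0.
  exists (\rank Ecs); last exact: subbundle_cst.
  rewrite lt0n mxrank_eq0; apply/eqP => E0.
  have : (vec 0 0 1 0 <= Ecs)%MS by apply/sub_EcsP; exists 0, 1, 0; rewrite mulr0 oppr0.
  rewrite E0 submx0 => /eqP/(congr1 (fun v : 'rV_4 => v 0 o2)); rewrite vecE mxE.
  by move/eqP; rewrite oner_eq0.
- move=> _; split.
    apply/andP; split; first exact: submx1.
    apply/rV_subP => v _.
    (* The coefficient of the orthogonal projection of [v] onto [(gr, 1, 0, 0)]. *)
    pose c := (gr * v 0 o0 + v 0 o1) / (gr ^+ 2 + 1).
    have -> : v = vec (gr * c) c 0 0 +
       vec (v 0 o0 - gr * c) (- (gr * (v 0 o0 - gr * c))) (v 0 o2) (v 0 o3).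
      rewrite {1}(vec_eta v) vecD; congr vec; rewrite ?add0r//; first by ring.
      rewrite /c; field; rewrite gt_eqF//; have := sqr_ge0 gr; lra.
    apply: addmx_sub_adds; first by apply/sub_EuP; exists c.
    by apply/sub_EcsP; exists (v 0 o0 - gr * c), (v 0 o2), (v 0 o3).
  apply/eqP; rewrite -submx0; apply/rV_subP => v; rewrite sub_capmx.
  move=> /andP[/sub_EuP[a ->] /sub_EcsP[b [u [w e]]]].
  have e0 := congr1 (fun v : 'rV_4 => v 0 o0) e.
  have e1 := congr1 (fun v : 'rV_4 => v 0 o1) e.
  rewrite !vecE in e0 e1.
  have : (gr ^+ 2 + 1) * a = 0.
    have -> : (gr ^+ 2 + 1) * a = gr * (gr * a) + a by ring.
    by rewrite e0 e1 addrN.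
  move/eqP; rewrite mulf_eq0 gt_eqF/=; last by have := sqr_ge0 gr; lra.
  move=> /eqP ->; rewrite mulr0.
  by rewrite submx0; apply/eqP; apply/rowP; apply: ord4_ind; rewrite vecE mxE.
- have inv (E : 'M[R]_4) :
      (forall (v : 'rV[R]_4) A B, (v <= E)%MS -> (v *m jac4 2 1 1 1 A B <= E)%MS) ->
      (forall (v : 'rV[R]_4) A B, (v <= E)%MS -> (v *m jac4 1 (-1) (-1) 2 A B <= E)%MS) ->
      invariant_bundle torusg (fun=> E).
    move=> h1 h2 p; rewrite tdiff_torusg; apply: jac4_stable => //.
      by have /andP[_] := dcmap_bounds (repr p 0 o2); move/lt0r_neq0.
    by rewrite lt0r_neq0// dbumpf_gt0.
  rewrite expr2 in g2; split; apply: inv.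
  + move=> _ A B /sub_EuP[a ->]; rewrite mul_vec_jac4; apply/sub_EuP; exists ((gr + 1) * a).
    have -> : gr * ((gr + 1) * a) = (gr * gr) * a + gr * a by ring.
    by rewrite g2; congr vec; ring.
  + move=> _ A B /sub_EuP[a ->]; rewrite mul_vec_jac4; apply/sub_EuP; exists ((2 - gr) * a).
    have -> : gr * ((2 - gr) * a) = 2 * gr * a - (gr * gr) * a by ring.
    by rewrite g2; congr vec; ring.
  + move=> _ A B /sub_EcsP[a [u [w ->]]]; rewrite mul_vec_jac4; apply/sub_EcsP.
    exists ((2 - gr) * a), (A * u), (B * w).
    have -> : gr * ((2 - gr) * a) = 2 * gr * a - (gr * gr) * a by ring.
    by rewrite g2; congr vec; ring.
  + move=> _ A B /sub_EcsP[a [u [w ->]]]; rewrite mul_vec_jac4; apply/sub_EcsP.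
    exists ((gr + 1) * a), (A * u), (B * w).
    have -> : gr * ((gr + 1) * a) = (gr * gr) * a + gr * a by ring.
    by rewrite g2; congr vec; ring.
(* Vectors of [Ecs] grow at most like [(3 / 2) ^ n], those of [Eu] like [(gr + 1) ^ n] with
   [gr + 1 > 5 / 2], so the ratio of the rates is below 3/4. Backwards, [Eu] contracts by
   [2 - gr < 1 / 2]. *)
- exists 1, (3 / 4); split; [by []|lra|].
  move=> p vu v n /sub_EuP[a ->] n1 /sub_EcsP[b [u [w ->]]] n2 n0.
  rewrite tdiff_torusg_unstable tdiff_torusV_unstable tdiff_torusg_center mul1r.
  rewrite !enorm_vecZ n1 !mulr1 !normrX.
  have s1 : 0 <= 2 - gr <= 1 / 2 by lra.
  rewrite (ger0_norm (_ : 0 <= 2 - gr)) ?(ger0_norm (_ : 0 <= gr + 1)); [|lra..].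
  have pw0 : 0 < (gr + 1) ^+ n by rewrite exprn_gt0//; lra.
  split; last by apply: lerXn2r; rewrite ?nnegrE; lra.
  rewrite ler_pdivrMr// -exprMn.
  apply: (@le_trans _ _ ((3 / 2) ^+ n)); last by apply: lerXn2r; rewrite ?nnegrE; lra.
  have h0 : 0 <= (2 - gr) ^+ n by rewrite exprn_ge0//; lra.
  have h1 : (2 - gr) ^+ n <= (3 / 2) ^+ n by apply: lerXn2r; rewrite ?nnegrE; lra.
  have pr (F : 'I_n -> R) (x : R) : (forall j, 0 <= F j <= 3 / 2) ->
      `|x * \prod_(j < n) F j| <= (3 / 2) ^+ n * `|x|.
    move=> hF; rewrite normrM mulrC ler_wpM2r//.
    rewrite ger0_norm; last by apply: prodr_ge0 => j _; have /andP[] := hF j.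
    rewrite -[X in _ ^+ X](card_ord n) -prodr_const.
    by apply: ler_prod => j _; exact: hF.
  rewrite -[leRHS]mulr1 -[X in _ <= _ * X]n2; apply: enorm_vec_le.
  + by apply: exprn_ge0; lra.
  + by rewrite normrM ger0_norm// ler_wpM2r.
  + by rewrite !normrN mulrCA [X in X <= _]normrM (ger0_norm h0) ler_wpM2r.
  + apply: pr => j; have /andP[/andP[]] := dcmap_bounds (iter j liftg (repr p) 0 o2); lra.
  + apply: pr => j; have := dbumpf_ge (iter j liftg (repr p) 0 o3).
    by have := dbumpf_le (iter j liftg (repr p) 0 o3); lra.
Qed.

(** The vector along [s] is stretched by a product of slopes that tend to 1, so the averages of
    their logarithms tend to 0. No point of the torus is exceptional. *)
Lemma torusg_lyapunov p : lyapunov_exponent torusg p 0.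
Proof.
exists (vec 0 0 1 0).
  apply/eqP => /(congr1 (fun v : 'rV_4 => v 0 o2)); rewrite vecE mxE.
  by move/eqP; rewrite oner_eq0.
pose x := repr p.
pose u (j : nat) : R := ln (dcmap (iter j cmap (x 0 o2))).
have itE j : iter j liftg x 0 o2 = iter j cmap (x 0 o2).
  elim: j => // j ih; rewrite iterS (vec_eta (iter j liftg x)) liftg_vec vecE ih.
  by [].
have pos j : 0 < dcmap (iter j cmap (x 0 o2)).
  by have /andP[] := dcmap_bounds (iter j cmap (x 0 o2)).
have cu : u j @[j --> \oo] --> 0.
  rewrite -ln1; apply: continuous_cvg; first exact: continuous_ln.
  rewrite /dcmap; under eq_fun do rewrite iter_cmap mulrC divfK//.
  exact: iter_dbumpf_cvg.
have := cesaro_avg cu; apply: cvg_trans; apply: near_eq_cvg; near=> n.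
congr (_ * _).
have -> : vec 0 0 1 0 = vec 0 (- (gr * 0)) 1 0 by rewrite mulr0 oppr0.
rewrite tdiff_torusg_center !mulr0 mul1r mul0r oppr0 enorm_vec.
rewrite expr0n/= !addr0 !add0r sqrtr_sqr.
under [X in `|X|]eq_bigr do rewrite itE.
rewrite ger0_norm; last by apply: prodr_ge0 => j _; exact: ltW.
by rewrite (ln_prod _ pos).
Unshelve. all: by end_near. Qed.

End Maps.

(** * Invariance of the measures *)

Section LebesgueFacts.
Variable R : realType.
Local Notation leb := (@lebesgue_measure R).

Lemma lebesgue_translation (A : set R) (c : R) : measurable A ->
  leb [set x | A (x + c)] = leb A.
Proof.
move=> mA.
have mt : measurable_fun setT (fun x : measurableTypeR R => x + c : measurableTypeR R).
  by apply: measurable_funD.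
apply/esym; apply: (@lebesgue_measure_unique R
  (pushforward leb (fun x : measurableTypeR R => x + c : measurableTypeR R))) => //.
move=> _ [[a b] _ <-] /=.
rewrite /pushforward (_ : _ @^-1` _ = `]a - c, b - c]%classic).
  rewrite !lebesgue_measure_itv/= !lte_fin ltrD2r; case: ifP => // _.
  by rewrite -!EFinB; congr EFin; ring.
by apply/seteqP; split => x /=; rewrite !in_itv/= ltrBlDr lerBrDr.
Qed.

(** The uniform law is given on the closed interval, while the half-open one is the fundamental
    domain; they differ by the null endpoint 1. *)
Lemma circle_probE (A : set R) : measurable A -> circle_prob R A = leb (A `&` `[0, 1[).
Proof.
move=> mA.
have -> : circle_prob R A = (\int[circle_prob R]_x (\1_A x)%:E)%E.
  by rewrite integral_indic// setIT.
rewrite integral_uniform//; last exact/measurable_EFinP/measurable_indic.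
rewrite subr0 invr1 mul1e integral_indic//.
have A1 : measurable (A `&` `[0, 1[%classic : set (measurableTypeR R)).
  by apply: measurableI.
have -> : A `&` `[0, 1]%classic = (A `&` `[0, 1[) `|` (A `&` [set 1]).
  by rewrite -setIUr setUitv1// bnd_simp.
apply/eqP; rewrite eq_le; apply/andP; split.
  apply: le_trans (measureU2 _ _ _) _ => //; first by apply: measurableI.
  rewrite -[leRHS]adde0 leeD2l//.
  by rewrite -(lebesgue_measure_set1 1) le_measure ?inE//; by apply: measurableI.
have mU : measurable ((A `&` `[0, 1[) `|` (A `&` [set 1]) : set (measurableTypeR R)).
  by apply: measurableU => //; apply: measurableI.
by apply: le_measure; rewrite ?inE//; exact: subsetUl.
Qed.

(** Periodicity reduces to [0 <= c < 1]. Translation turns the window [[0, 1[] into [[c, c + 1[],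
    and the part beyond 1 is moved back onto [[0, c[]. *)
Lemma circle_prob_translation (A : set R) (c : R) : measurable A ->
  (forall x, A (x + 1) = A x) ->
  circle_prob R [set x | A (x + c)] = circle_prob R A.
Proof.
move=> mA perA.
have mt (B : set R) (b : R) : measurable B -> measurable [set x | B (x + b)].
  move=> mB; rewrite -[X in measurable X]setTI.
  have : measurable_fun setT (fun x : measurableTypeR R => x + b : measurableTypeR R).
    by apply: measurable_funD.
  by apply.
have perN (n : nat) x : A (x + n%:R) = A x.
  by elim: n => [|n ih]; rewrite ?addr0// -natr1 addrA perA.
have perZ (m : int) x : A (x + m%:~R) = A x.
  case: m => n; first exact: perN.
  by rewrite NegzE intrN -(perN n.+1 (x - _)) subrK.
wlog : c / 0 <= c < 1 => [hw|/andP[c0 c1]].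
  rewrite -[RHS](hw (c - (Num.floor c)%:~R)).
    congr (circle_prob R _); apply/funext => x /=.
    by rewrite -(perZ (Num.floor c) (x + (c - _))) -addrA subrK.
  rewrite subr_ge0 floor_le/= ltrBlDl -(intrD _ _ 1).
  exact: floorD1_gt.
rewrite !circle_probE//; last exact: mt.
have mI (B : set R) a b : measurable B ->
    measurable (B `&` `[a, b[%classic : set (measurableTypeR R)).
  by move=> mB; apply: measurableI .
have -> : [set x | A (x + c)] `&` `[0, 1[ = [set x | (A `&` `[c, c + 1[%classic) (x + c)].
  apply/seteqP; split => x /=; rewrite !in_itv/= => -[Ax h]; split => //; lra.
rewrite lebesgue_translation; last exact: mI.
have -> : A `&` `[c, c + 1[%classic = (A `&` `[c, 1[) `|` (A `&` `[1, c + 1[).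
  rewrite -setIUr; congr (_ `&` _); apply/seteqP; split => x /=; rewrite !in_itv/=.
    by move=> /andP[h1 h2]; case: (ltrP x 1) => h3; [left|right]; lra.
  by move=> [|] /andP[h1 h2]; lra.
have -> : A `&` `[0, 1[%classic = (A `&` `[c, 1[) `|` (A `&` `[0, c[).
  rewrite -setIUr; congr (_ `&` _); apply/seteqP; split => x /=; rewrite !in_itv/=.
    by move=> /andP[h1 h2]; case: (ltrP x c) => h3; [right|left]; lra.
  by move=> [|] /andP[h1 h2]; lra.
have disj (a b : R) (r : R) : (A `&` `[a, r[%classic) `&` (A `&` `[r, b[%classic) = set0.
  by apply/seteqP; split => // x [[_ /=]]; rewrite in_itv/= => h1 [_ /=]; rewrite in_itv/=; lra.
rewrite (measureU leb (mI A c 1 mA) (mI A 1 (c + 1) mA) (disj c (c + 1) 1)).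
rewrite setUC (measureU leb (mI A 0 c mA) (mI A c 1 mA) (disj 0 1 c)) addeC.
congr (_ + _)%E.
apply: (etrans (esym (lebesgue_translation 1 (mI A 1 (c + 1) mA)))).
congr (leb _); apply/seteqP; split => x /=; rewrite !in_itv/= perA => -[Ax h]; split => //; lra.
Qed.

(* Lebesgue measure of an arbitrary set is the outer measure and the integral of an
   arbitrary nonnegative function is a lower integral, so this holds without
   measurability. *)
Lemma le_product_lebesgue d (T : measurableType d) (m : {measure set T -> \bar R})
  (A B : set (T * R)) : A `<=` B -> ((m \x leb) A <= (m \x leb) B)%E.
Proof.
move=> AB; rewrite /product_measure1.
rewrite !ge0_integralTE; last 2 first.
- by move=> x.
- by move=> x.
apply: le_ereal_sup => _ [h hA <-]; exists h => // x.
apply: le_trans (hA x) _ => /=.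
apply: le_mu_ext => y; rewrite /xsection/= !inE; exact: AB.
Qed.

(** Links the Borel sets of the torus, generated by open sets, to the product sigma-algebra of the
    plane: an open set is a countable union of rational boxes. *)
Lemma measurable_open2 (O : set (R * R)) : open O ->
  measurable (O : set (measurableTypeR R * measurableTypeR R)).
Proof.
move=> oO.
pose box (a b c e : R) : set (R * R) := `]a, b[ `*` `]c, e[.
pose F (a b c e : rat) := box (ratr a) (ratr b) (ratr c) (ratr e).
have -> : O = \bigcup_a \bigcup_b \bigcup_c \bigcup_(e in [set e | F a b c e `<=` O]) F a b c e.
  apply/seteqP; split; last first.
    by move=> z [a _ [b _ [c _ [e /= FO Fz]]]]; exact: FO.
  move=> [x y] Oxy.
  have /nbhs_ballP[r /= r0 hr] := open_nbhs_nbhs (conj oO Oxy).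
  have lt1 (u : R) : u - r < u by rewrite ltrBlDr ltrDl.
  have lt2 (u : R) : u < u + r by rewrite ltrDl.
  have [a] := rat_in_itvoo (lt1 x); rewrite in_itv/= => /andP[a1 a2].
  have [b] := rat_in_itvoo (lt2 x); rewrite in_itv/= => /andP[b1 b2].
  have [c] := rat_in_itvoo (lt1 y); rewrite in_itv/= => /andP[c1 c2].
  have [e] := rat_in_itvoo (lt2 y); rewrite in_itv/= => /andP[e1 e2].
  exists a => //; exists b => //; exists c => //; exists e; last first.
    by split => /=; rewrite in_itv/= ?a2 ?b1 ?c2 ?e1.
  move=> [u v] [/=]; rewrite !in_itv/= => /andP[u1 u2] /andP[v1 v2].
  by apply: hr; split; rewrite /ball/= ltr_distl; apply/andP; split; lra.
do 3 (apply: bigcupT_measurable_rat => ?).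
rewrite bigcup_mkcond; apply: bigcupT_measurable_rat => e.
by case: ifP => // _; exact: measurableX.
Qed.

End LebesgueFacts.

(** * Invariance of area under the cat map *)

Section CatInvariance.
Variable R : realType.

(** On the vertical fibre over [x] the shear is the translation by [x]. *)
Lemma square_prob_shear1 (A : set (R * R)) :
  measurable (A : set (measurableTypeR R * measurableTypeR R)) ->
  (forall x y, A (x, y + 1) = A (x, y)) ->
  square_prob R [set z | A (z.1, z.1 + z.2)] = square_prob R A.
Proof.
move=> mA perA; rewrite /square_prob/= /product_measure1.
apply: eq_integral => x _ /=.
rewrite -(@circle_prob_translation R (xsection A x) x); last 2 first.
- exact: measurable_xsection.
- by move=> y; rewrite /xsection/= !in_setE perA.
congr (circle_prob R _); apply/funext => y; rewrite /xsection/= !in_setE/=.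
by rewrite addrC.
Qed.

(** The second shear translates horizontal fibres, which calls for the iterated integral in the
    other order. *)
Lemma square_prob_ysection (A : set (R * R)) :
  measurable (A : set (measurableTypeR R * measurableTypeR R)) ->
  square_prob R A = (\int[circle_prob R]_y circle_prob R (ysection A y))%E.
Proof.
move=> mA; rewrite -[RHS]/((circle_prob R \x^ circle_prob R)%E A).
apply: product_measure_unique => // B C mB mC.
exact: (product_measure2E (circle_prob R) (circle_prob R) mB mC).
Qed.

Lemma measurable_shear2 (A : set (R * R)) :
  measurable (A : set (measurableTypeR R * measurableTypeR R)) ->
  measurable ([set z | A (z.1 + z.2, z.2)] : set (measurableTypeR R * measurableTypeR R)).
Proof.
move=> mA; rewrite -[X in measurable X]setTI.
have : measurable_fun setT (fun z : measurableTypeR R * measurableTypeR R =>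
   (z.1 + z.2, z.2) : measurableTypeR R * measurableTypeR R).
  by apply: measurable_fun_pair => //; apply: measurable_funD.
by apply.
Qed.

Lemma square_prob_shear2 (A : set (R * R)) :
  measurable (A : set (measurableTypeR R * measurableTypeR R)) ->
  (forall x y, A (x + 1, y) = A (x, y)) ->
  square_prob R [set z | A (z.1 + z.2, z.2)] = square_prob R A.
Proof.
move=> mA perA; apply: (etrans (square_prob_ysection (measurable_shear2 mA))).
apply: (etrans _ (esym (square_prob_ysection mA))).
apply: eq_integral => y _ /=.
rewrite -(@circle_prob_translation R (ysection A y) y); last 2 first.
- exact: measurable_ysection.
- by move=> x; rewrite /ysection/= !in_setE perA.
by congr (circle_prob R _); apply/funext => x; rewrite /ysection/= !in_setE.
Qed.

(* The cat map is the composition of the two shears. *)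
Lemma square_prob_catmap (A : set (R * R)) :
  measurable (A : set (measurableTypeR R * measurableTypeR R)) ->
  (forall x y, A (x + 1, y) = A (x, y)) -> (forall x y, A (x, y + 1) = A (x, y)) ->
  square_prob R [set z | A (catmap z)] = square_prob R A.
Proof.
move=> mA per1 per2.
pose B := [set z : R * R | A (z.1 + z.2, z.2)].
rewrite -(square_prob_shear2 mA per1) -/B.
have -> : [set z | A (catmap z)] = [set z | B (z.1, z.1 + z.2)].
  have e (z : R * R) : catmap z = (z.1 + (z.1 + z.2), z.1 + z.2).
    by rewrite /catmap; congr pair; ring.
  by apply/funext => z; rewrite /B/= e.
apply: square_prob_shear1; first exact: measurable_shear2.
by move=> x y; rewrite /B/= addrA per2 per1.
Qed.

Definition unit_square : set (R * R) := `[0, 1[ `*` `[0, 1[.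

Lemma square_probE (A : set (R * R)) :
  measurable (A : set (measurableTypeR R * measurableTypeR R)) ->
  square_prob R A = ((@lebesgue_measure R \x @lebesgue_measure R) (unit_square `&` A))%E.
Proof.
move=> mA.
have mI : measurable (`[0, 1[%classic : set (measurableTypeR R)) by [].
have msq : measurable (unit_square : set (measurableTypeR R * measurableTypeR R)).
  exact: measurableX.
pose leb2 : {measure set (measurableTypeR R * measurableTypeR R) -> \bar R} :=
  (@lebesgue_measure R \x @lebesgue_measure R)%E.
rewrite setIC -[RHS]/(mrestr leb2 msq A).
apply: product_measure_unique => // B C mB mC.
have e : (B `*` C) `&` unit_square = (B `&` `[0%R, 1%R[) `*` (C `&` `[0%R, 1%R[).
  by rewrite setXI.
apply: (etrans (congr1 leb2 e)).
apply: (etrans (product_measure1E _ _ _ _)); [exact: measurableI|exact: measurableI|].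
by congr (_ * _)%E; apply/esym/circle_probE.
Qed.

Lemma measurable_unit_square :
  measurable (unit_square : set (measurableTypeR R * measurableTypeR R)).
Proof. by apply: measurableX; exact: measurable_itv. Qed.

End CatInvariance.

(** * Physical measures *)

Section PhysicalMeasures.
Variables (R : realType) (l : nat).
Hypothesis l0 : (0 < l)%N.
Local Notation T := (torus R 4).
Local Notation proj := (@torus_proj R 4).
Local Notation R2 := (measurableTypeR R * measurableTypeR R)%type.
Local Notation g := (@torusg R l).

Let lR : 0 < l%:R :> R. Proof. by rewrite ltr0n. Qed.

(** Parametrizes the invariant 2-torus over the fixed points [i / l] and 0 by the plane, so that
    functions on it become doubly periodic functions. *)
Definition sinkmap (i : 'I_l) (z : R * R) : T := proj (vec z.1 z.2 (i%:R / l%:R) 0).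

Lemma continuous_sinkmap i : continuous (sinkmap i).
Proof.
move=> z; apply: (@continuous_comp _ _ _ (fun z : R * R => vec z.1 z.2 (i%:R / l%:R) 0) proj);
  last exact: torus_proj_continuous.
have -> : (fun z : R * R => vec z.1 z.2 (i%:R / l%:R) 0) =
    (fun z => z.1 *: (delta_mx 0 o0 : 'rV[R]_4) +
      (z.2 *: (delta_mx 0 o1 : 'rV[R]_4) + vec 0 0 (i%:R / l%:R) 0)).
  by apply/funext => y; apply/rowP; apply: ord4_ind; rewrite !mxE/=; ring.
have Fz := nbhs_filter z.
apply: cvgD; last (apply: cvgD; last exact: cvg_cst).
  apply: (@continuous_comp _ _ _ (fun z : R * R => z.1) ( *:%R ^~ (delta_mx 0 o0 : 'rV[R]_4))).
    exact: cvg_fst.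
  exact: scalel_continuous.
apply: (@continuous_comp _ _ _ (fun z : R * R => z.2) ( *:%R ^~ (delta_mx 0 o1 : 'rV[R]_4))).
  exact: cvg_snd.
exact: scalel_continuous.
Qed.

Lemma measurable_sinkmap i : measurable_fun setT (sinkmap i : R2 -> T).
Proof.
apply: (@measurability _ _ _ _ setT (sinkmap i) (@open T)) => //.
move=> _ [U oU <-]; rewrite setTI; apply: measurable_open2.
by apply: open_comp => // z _; exact: continuous_sinkmap.
Qed.

HB.instance Definition _ i := isMeasurableFun.Build _ _ _ _ (sinkmap i : R2 -> T)
  (measurable_sinkmap i).

Definition sink_measure i : probability T R :=
  distribution (square_prob R) (sinkmap i : {mfun R2 >-> T}).

Lemma sink_measureE i A : sink_measure i A = square_prob R (sinkmap i @^-1` A).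
Proof. by []. Qed.

Lemma sinkmap_shift i (m n : int) z :
  sinkmap i (z.1 + m%:~R, z.2 + n%:~R) = sinkmap i z.
Proof.
rewrite /sinkmap/= -[RHS](@torus_projD _ _ _ (vec m%:~R n%:~R 0 0)).
  by rewrite vecD !addr0.
by apply: ord4_ind; rewrite vecE ?rpred0// intr_int.
Qed.

Lemma torusg_sinkmap i z : g (sinkmap i z) = sinkmap i (catmap z).
Proof.
rewrite /torusg /sinkmap torus_map_proj; last exact: liftg_equivariant.
have li : l%:R * (i%:R / l%:R) = i%:R :> R by rewrite mulrC divfK// gt_eqF.
rewrite liftg_vec /cmap li.
have b0 : bumpf 0 = 0 :> R by have := @bumpf_int R 0.
by rewrite b0 (_ : bumpf i%:R = i%:R)//; have := @bumpf_int R i.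
Qed.

Lemma sink_measure_invariant i : invariant_measure g (sink_measure i).
Proof.
move=> A mA; rewrite !sink_measureE.
have mD : measurable (sinkmap i @^-1` A : set R2).
  by rewrite -[X in measurable X]setTI; exact: measurable_sinkmap.
rewrite -(square_prob_catmap mD).
- by congr (square_prob R _); apply/funext => z; rewrite /preimage/= torusg_sinkmap.
- move=> x y; rewrite /preimage/=.
  by have := sinkmap_shift i 1 0 (x, y); rewrite /= addr0 => ->.
- move=> x y; rewrite /preimage/=.
  by have := sinkmap_shift i 0 1 (x, y); rewrite /= addr0 => ->.
Qed.

(** The measures live on disjoint 2-tori: [cos (2 pi (s - i / l))] equals 1 on the [i]-th and
    differs from 1 on the [j]-th, as [0 < |j - i| < l]. *)
Lemma sink_measure_neq i j : i != j ->
  exists2 A : set T, measurable A & sink_measure i A <> sink_measure j A.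
Proof.
move=> ij; pose chi0 (v : 'rV[R]_4) : R := cos (pi *+ 2 * (v 0 o2 - i%:R / l%:R)).
pose chi (p : T) := chi0 (repr p).
have chiE v : chi (proj v) = chi0 v.
  have /torus_projP/(_ o2)/intrP[m] := torus_proj_repr (proj v).
  rewrite !mxE => /eqP; rewrite subr_eq => /eqP e.
  rewrite /chi /chi0 e; have -> : pi *+ 2 * (m%:~R + v 0 o2 - i%:R / l%:R) =
    pi *+ 2 * (v 0 o2 - i%:R / l%:R) + pi *+ 2 * m%:~R by ring.
  exact: cosD2piz.
have cchi : continuous chi.
  apply: torus_continuousP; rewrite (_ : _ \o _ = chi0); last exact/funext.
  move=> v; apply: continuous_comp; last exact: continuous_cos.
  have Fv := nbhs_filter v.
  apply: cvgM; first exact: cvg_cst.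
  by apply: cvgB; [exact: coord_continuous|exact: cvg_cst].
exists (chi @^-1` [set 1]).
  by rewrite -[X in measurable X]setTI; apply: measurable_torus_continuous.
rewrite !sink_measureE.
have -> : sinkmap i @^-1` (chi @^-1` [set 1]) = setT.
  apply/seteqP; split => // z _ /=.
  by rewrite /sinkmap chiE /chi0 vecE subrr mulr0 cos0.
have -> : sinkmap j @^-1` (chi @^-1` [set 1]) = set0.
  apply/seteqP; split => // z /=.
  rewrite /sinkmap chiE /chi0 vecE -mulrBl.
  have -> : j%:R - i%:R = (j%:Z - i%:Z)%:~R :> R by rewrite intrB.
  move/eqP; rewrite eq_sym -subr_eq0 cos_half_angle mulf_eq0 expf_eq0/= pnatr_eq0/=.
  apply/negP; apply: sin_pi_frac_neq0.
  have := ltn_ord i; have := ltn_ord j; have : (i : nat) != j by [].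
  by lia.
rewrite measure0 probability_setT; apply/eqP.
by rewrite eqe oner_eq0.
Qed.

Lemma Rint_sink_measure i (phi : T -> R) : continuous phi ->
  \int[sink_measure i]_p phi p = \int[square_prob R]_z phi (sinkmap i z).
Proof.
move=> cphi; have mphi := measurable_torus_continuous cphi.
have [M hM] := torus_bounded cphi.
rewrite /Rintegral /sink_measure integral_distribution//.
  exact/measurable_EFinP.
apply: bmfun_integrable; split; last by exists M => z; exact: hM.
exact: measurableT_comp mphi (measurable_sinkmap i).
Qed.

Lemma Rint_empirical p n (phi : T -> R) : continuous phi ->
  \int[empirical_measure g p n]_q phi q = n%:R^-1 * \sum_(j < n) phi (iter j g p).
Proof.
move=> cphi; have mphi := measurable_torus_continuous cphi.
(* The integration rules for scaled sums of measures concern nonnegative functions, so [phi] is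
   later split into its positive and negative parts. *)
have ge0 (f : T -> R) : measurable_fun setT f -> (forall q, 0 <= f q) ->
    (\int[empirical_measure g p n]_q (f q)%:E =
     (n%:R^-1 * \sum_(j < n) f (iter j g p))%:E)%E.
  move=> mf f0.
  have mfE : measurable_fun setT (EFin \o f) by exact/measurable_EFinP.
  rewrite /empirical_measure ge0_integral_mscale//=; last by move=> q _; rewrite lee_fin.
  rewrite ge0_integral_measure_sum//; last by move=> q _; rewrite lee_fin.
  rewrite EFinM -sumEFin; congr (_ * _)%E; apply: eq_bigr => j _.
  by rewrite integral_dirac// diracT mul1e.
have mp : measurable_fun setT (fun q => Num.max (phi q) 0) by apply: measurable_maxr.
have mn : measurable_fun setT (fun q => Num.max (- phi q) 0).
  by apply: measurable_maxr => //; exact: measurable_funN.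
rewrite /Rintegral integralE.
rewrite (eq_integral (fun q => (Num.max (phi q) 0)%:E)); last first.
  by move=> q _; rewrite funeposE -EFin_max.
rewrite [X in (_ - X)%E](eq_integral (fun q => (Num.max (- phi q) 0)%:E)); last first.
  by move=> q _; rewrite funenegE -EFinN -EFin_max.
rewrite !ge0//; last 2 first.
- by move=> q; rewrite le_max lexx orbT.
- by move=> q; rewrite le_max lexx orbT.
rewrite -EFinB/= -mulrBr -sumrB; congr (_ * _); apply: eq_bigr => j _.
by rewrite /Num.max; case: ltP => h1; case: ltP => h2; lra.
Qed.

(** The orbit shadows the cat map orbit of [(x, y)] on the sink torus: the circle coordinates
    converge, so by uniform continuity the values of [phi] along the two orbits differ by a null
    sequence, whose Cesaro means tend to 0. The sink is the class of [ceil (l s)] modulo [l], and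
    [m] counts whole turns. *)
Lemma basin_sink (x y s t : R) (i : 'I_l) (m : int) : generic_pt (x, y) ->
  Num.ceil (l%:R * s) = i%:Z + m * l%:Z -> basin g (sink_measure i) (proj (vec x y s t)).
Proof.
move=> gz em phi cphi.
rewrite Rint_sink_measure//.
under eq_fun do rewrite Rint_empirical//.
pose psi z := phi (sinkmap i z).
have [M hM] := torus_bounded cphi.
have bpsi : @bmfun _ R2 R psi.
  split; last by exists M => z; exact: hM.
  exact: measurableT_comp (measurable_torus_continuous cphi) (measurable_sinkmap i).
have per : doubly_periodic psi by move=> p a b; rewrite /psi sinkmap_shift.
have ucphi := torus_unif_continuous cphi.
have uc : unif_cont2 psi.
  move=> e e0; have [del del0 hdel] := ucphi _ e0; exists del => // p q h1 h2.
  by apply: hdel; apply: ord4_ind; rewrite !vecE// subrr normr0.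
have [_ cpsi] := equidistributed_cont gz per bpsi uc.
pose z j := iter j (@catmap R) (x, y).
pose d j := phi (iter j g (proj (vec x y s t))) - psi (z j).
have itE j : iter j (@liftg R l) (vec x y s t) =
    vec (z j).1 (z j).2 (iter j (@cmap R l) s) (iter j (@bumpf R) t).
  by elim: j => // j ih; rewrite iterS ih liftg_vec.
have cd : d j @[j --> \oo] --> 0.
  apply/cvgrPdist_lt => e e0; have [del del0 hdel] := ucphi _ e0.
  have /cvgrPdist_lt/(_ _ del0) ct := @iter_bumpf_cvg R t.
  have dl0 : 0 < del * l%:R by rewrite mulr_gt0.
  have /cvgrPdist_lt/(_ _ dl0) cs := @iter_bumpf_cvg R (l%:R * s).
  near=> j; rewrite sub0r normrN /d.
  rewrite iter_torus_map_proj; last exact: liftg_equivariant.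
  (* Uniform continuity compares points of [R^4], so the sink point is represented with circle
     coordinates at the actual limits of the lifted orbit. *)
  have -> : psi (z j) = phi (proj (vec (z j).1 (z j).2
      ((Num.ceil (l%:R * s))%:~R / l%:R) (Num.ceil t)%:~R)).
    rewrite /psi /sinkmap -(@torus_projD _ _ _ (vec 0 0 m%:~R (Num.ceil t)%:~R)).
      rewrite vecD !addr0 add0r em intrD intrM mulrDl -!pmulrn.
      by rewrite mulfK ?gt_eqF.
    by apply: ord4_ind; rewrite vecE ?rpred0// intr_int.
  rewrite itE; apply: hdel; apply: ord4_ind; rewrite !vecE ?subrr ?normr0//.
    rewrite iter_cmap// -mulrBl normrM normfV [X in _ / X]gtr0_norm// ltr_pdivrMr//.
    by rewrite distrC; near: j.
  by rewrite distrC; near: j.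
have cav : birkhoff psi (x, y) n + n%:R^-1 * (\sum_(j < n) d j) @[n --> \oo] -->
    \int[square_prob R]_z psi z.
  by rewrite -[X in _ --> X]addr0; apply: cvgD => //; exact: cesaro_avg.
apply: (cvg_trans _ cav); apply: near_eq_cvg; near=> n.
rewrite /birkhoff -mulrDr -big_split/=; congr (_ * _); apply: eq_bigr => j _.
by rewrite /d addrC subrK.
Unshelve. all: by end_near. Qed.

End PhysicalMeasures.

(** * Lebesgue measure of the basins *)

Section FullBasin.
Variables (R : realType) (l : nat).
Hypothesis l0 : (0 < l)%N.
Local Notation T := (torus R 4).
Local Notation R2 := (measurableTypeR R * measurableTypeR R)%type.
Local Notation g := (@torusg R l).
Local Notation leb := (@lebesgue_measure R).

Let lR : 0 < l%:R :> R. Proof. by rewrite ltr0n. Qed.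

Lemma generic_null_set : exists N : set (R * R),
  [/\ measurable (N : set R2), square_prob R N = 0%E & forall z, ~ N z -> generic_pt z].
Proof.
have [N [mN N0 hN]] := ae_generic R; exists N; split=> // z Nz.
by apply: contrapT => gz; apply: Nz; exact: hN.
Qed.

Lemma lebesgue4_box (A : set (R * R)) (S I : set R) :
  measurable (A : set R2) -> measurable (S : set (measurableTypeR R)) ->
  measurable (I : set (measurableTypeR R)) ->
  (leb \x leb \x leb \x leb)%E (A `*` S `*` I) = ((leb \x leb) A * leb S * leb I)%E.
Proof.
move=> mA mS mI.
apply: (etrans (product_measure1E _ _ _ _)) => //; first exact: measurableX.
by congr (_ * _)%E; exact: product_measure1E.
Qed.

Lemma row4_vec (x : R * R * R * R) : row4 x = vec x.1.1.1 x.1.1.2 x.1.2 x.2.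
Proof. by rewrite /vec -!surjective_pairing. Qed.

(** The basin contains a box, the product of the generic pairs, an arc of length [1 / l] and a full
    circle, of measure [1 / l]. *)
Lemma lebesgue_basin_gt0 (i : 'I_l) : (0 < lebesgue_torus4 (basin g (sink_measure R i)))%E.
Proof.
have [N [mN N0 hN]] := generic_null_set.
(* The sink [0] attracts the arc on its left, which lies at the end of [0, 1[. *)
pose k : nat := if i == 0%N :> nat then l else i.
have k0 : (0 < k)%N by rewrite /k; case: eqVneq => //; rewrite lt0n.
have kl : (k <= l)%N by rewrite /k; case: eqVneq => // _; exact: ltnW.
have [m km] : exists m : int, k%:Z = i%:Z + m * l%:Z.
  rewrite /k; case: eqVneq => [->|_]; first by exists 1; rewrite mul1r add0r.
  by exists 0; rewrite mul0r addr0.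
pose S : set R := `](k%:R - 1) / l%:R, k%:R / l%:R[%classic.
have S01 : S `<=` `[0, 1[%classic.
  move=> s; rewrite /S/= !in_itv/= => /andP[s1 s2]; apply/andP; split.
    by apply: ltW; apply: le_lt_trans s1; rewrite divr_ge0 ?subr_ge0 ?ler1n.
  by apply: (lt_le_trans s2); rewrite ler_pdivrMr// mul1r ler_nat.
have sub : (@unit_square R `&` ~` N) `*` S `*` `[0, 1[%classic `<=`
    @unit_cube R `&` (@torus_proj R 4 \o @row4 R) @^-1` basin g (sink_measure R i).
  move=> [[[x y] s] t] [[[[/= x1 y1] /hN Nxy] Ss] t1]; split.
    by split; [split; [split|exact: S01]|].
  rewrite /= row4_vec/=; apply: (@basin_sink R l l0 _ _ _ _ _ m) => //.
  rewrite -km; apply: ceil_def; move: Ss; rewrite /S/= in_itv/= => /andP[].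
  rewrite ltr_pdivrMr// ltr_pdivlMr// intrB -!pmulrn => h1 h2.
  by rewrite (mulrC _ s) h1/= ltW.
rewrite /lebesgue_torus4; apply: (lt_le_trans _ (le_product_lebesgue (leb \x leb \x leb)%E sub)).
have mA : measurable ((@unit_square R) `&` ~` N : set R2).
  by apply: measurableI; [exact: measurable_unit_square|exact: measurableC].
have mS : measurable (S : set (measurableTypeR R)) by exact: measurable_itv.
rewrite lebesgue4_box//.
have -> : ((leb \x leb) ((@unit_square R) `&` ~` N) = 1)%E.
  rewrite -square_probE; last exact: measurableC.
  by rewrite probability_setC// [X in (1 - X)%E]N0 sube0.
rewrite !lebesgue_measure_itv/= !lte_fin ltr01 ltr_pM2r ?invr_gt0// gtrBl ltr01.
by rewrite -!EFinB mul1e -EFinM lte_fin subr0 mulr1 -mulrBl opprB addrC subrK mul1r invr_gt0.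
Qed.

Lemma lebesgue_basins_full :
  lebesgue_torus4 (~` \bigcup_(i in [set: 'I_l]) basin g (sink_measure R i)) = 0%E.
Proof.
have [N [mN N0 hN]] := generic_null_set.
(* The unbounded factors are harmless: the first factor has measure 0, and [0 * +oo = 0]. *)
have sub : @unit_cube R `&` (@torus_proj R 4 \o @row4 R) @^-1`
      (~` \bigcup_(i in [set: 'I_l]) basin g (sink_measure R i)) `<=`
    (@unit_square R `&` N) `*` setT `*` setT.
  move=> [[[x y] s] t] [[[[/= x1 y1] s1] t1] nb]; do 2 split => //; split=> //.
  apply: contrapT => /hN gxy; apply: nb.
  (* The remainder of [c] modulo [l] is the sink that attracts [s]; the quotient is the number of
     turns. *)
  pose c := Num.ceil (l%:R * s).
  have lz : l%:Z != 0 by rewrite -lt0n.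
  have c0 : (0 <= c %% l%:Z)%Z by exact: modz_ge0.
  have cl : (`|(c %% l%:Z)%Z| < l)%N.
    by rewrite -ltz_nat gez0_abs// ltz_pmod.
  exists (Ordinal cl) => //.
  rewrite row4_vec/=; apply: (@basin_sink R l l0 _ _ _ _ _ (c %/ l%:Z)%Z) => //=.
  by rewrite gez0_abs// addrC -divz_eq.
apply/eqP; rewrite eq_le measure_ge0 andbT.
rewrite /lebesgue_torus4; apply: (le_trans (le_product_lebesgue (leb \x leb \x leb)%E sub)).
rewrite lebesgue4_box//; last first.
  by apply: measurableI => //; exact: measurable_unit_square.
by rewrite -square_probE// [X in (X * _ * _)%E]N0 !mul0e.
Qed.

End FullBasin.

Theorem theorem0p3 (R : realType) (l : nat) (hl : (0 < l)%N) :
  exists g ginv : torus R 4 -> torus R 4,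
  [/\ C1_diffeo g ginv,
      partially_hyperbolic g ginv,
      exists mu : 'I_l -> probability (torus R 4) R,
        [/\ forall i, physical_measure g (mu i),
            forall i j, i != j ->
              exists2 A : set (torus R 4), measurable A & mu i A <> mu j A &
            lebesgue_torus4 (~` \bigcup_(i in [set: 'I_l]) basin g (mu i)) = 0%E] &
      forall mu : probability (torus R 4) R,
        physical_measure g mu -> ~ hyperbolic_measure g mu].
Proof.
exists (@torusg R l), (@torusV R l); split.
- exact: torusg_C1_diffeo.
- exact: torusg_partially_hyperbolic.
- exists (@sink_measure R l); split.
  + move=> i; split; first exact: sink_measure_invariant.
    exact: lebesgue_basin_gt0.
  + exact: sink_measure_neq.
  + exact: lebesgue_basins_full.
- move=> mu _ [N [mN N0 hN]].
  (* Since 0 is an exponent at every point, hyperbolicity would make the whole torus a null set. *)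
  have NT : N = setT.
    apply/seteqP; split => // p _; apply: hN => /= h.
    by have := h 0 (torusg_lyapunov hl p); rewrite eqxx.
  by move: N0; rewrite NT [LHS]probability_setT => /eqP; rewrite eqe oner_eq0.
Qed.
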